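(* Let $G=(V,E)$ be a finite, simple, connected graph, and let $\partial G$ denote its Steinerberger boundary. \begin{enumerate} \item[(a)] $|\partial G|=2$ if and only if $G$ is a path graph with at least two vertices. \item[(b)] $|\partial G|=3$ if and only if $G$ is a tree with exactly three leaves or a tripod. \item[(c)] $|\partial G|=4$ if and only if $G$ is a tree with exactly four leaves, or $G$ is obtained from one of the graphs $H_1,\dots,H_7$ below by attaching, at each vertex $v\in\partial H_i$ with boundary stability number $\beta_{H_i}(v)=1$, exactly one path of arbitrary length $\ell_v\ge 0$: \begin{itemize} \item $H_1$: the wheel on five vertices (a $4$-cycle $a_1a_2a_3a_4a_1$ together with a hub $h$ adjacent to all $a_i$); here $\partial H_1=\{a_1,\dots,a_4\}$ with $\beta=3$ each, so no paths are attached; \item $H_2$: the cycle $C_4$; every vertex has $\beta=2$, so no paths are attached; \item $H_3$: the complete graph $K_4$; every vertex has $\beta=1$, so a path is attached at each of the four vertices; \item $H_4$: $H_1$ with one rim edge $a_1a_2$ deleted; $\partial H_4=\{a_1,\dots,a_4\}$ with $\beta=2$ each, so no paths are attached; \item $H_5$: $K_4$ with one edge deleted; the two vertices of degree $3$ have $\beta=1$ and receive paths, the two vertices of degree $2$ have $\beta=2$ and receive none; \item $H_6$: two triangles $\{a,b,m\}$ and $\{c,d,m'\}$ joined by a path from $m$ to $m'$ of any length $k\ge 0$ (when $k=0$, $m=m'$ and the triangles share this vertex); paths are attached at $a,b,c,d$; \item $H_7$: a triangle $\{a,b,m\}$, a path from $m$ to a vertex $m'$ of any length $k\ge0$ (with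 $m=m'$ if $k=0$), and two further vertices $c,d$ each adjacent only to $m'$; paths are attached at $a,b,c,d$. \end{itemize} \end{enumerate}
   Context: All graphs are finite, simple and undirected; $d(v,u)$ is the shortest-path distance and $N(v)$ the neighbourhood of $v$. For a connected graph $G=(V,E)$, the Steinerberger boundary is $\partial G=\{v\in V:\ \exists u\in V \text{ with } \frac{1}{\deg(v)}\sum_{w\in N(v)} d(w,u)<d(v,u)\}$, with the convention $\partial G=V$ if $|V|=1$. For $v,u\in V$ define $\beta_G(v,u)=\sum_{w\in N(v)}[d(v,u)-d(w,u)]$ and the boundary stability number $\beta_G(v)=\max_{u\in V}\beta_G(v,u)$. A tripod is a graph obtained from the triangle $K_3$ by attaching to each of its three vertices a path of arbitrary length (possibly $0$). Attaching a path of length $\ell\ge 0$ at a vertex $v$ means adding new vertices $x_1,\dots,x_\ell$ and edges $vx_1,x_1x_2,\dots,x_{\ell-1}x_\ell$ (nothing is added if $\ell=0$). *)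

(* Defs.v *)
From HB Require Import structures.
From mathcomp Require Import all_boot all_order all_algebra.

Set Implicit Arguments.
Unset Strict Implicit.
Unset Printing Implicit Defensive.

Import Order.TTheory GRing.Theory Num.Theory.

Record sgraph := SGraph {
  vertex :> finType;
  edge : rel vertex;
  edge_sym : symmetric edge;
  edge_irrefl : irreflexive edge
}.
Arguments edge {s}.

Definition connected (G : sgraph) : Prop :=
  0 < #|{: G}| /\ forall x y : G, connect edge x y.

Definition isomorphic (G H : sgraph) : Prop :=
  exists2 f : G -> H, bijective f & {mono f : x y / edge x y}.

Section Invariants.

Variable G : sgraph.

Definition nbhd (v : G) : {set G} := [set w | edge v w].

Definition deg (v : G) : nat := #|nbhd v|.

Definition has_walk (x y : G) (n : nat) : bool :=
  [exists p : n.-tuple G, path edge x p && (last x p == y)].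

(* The least length of a walk from x to y. A shortest walk has fewer than
   #|G| edges, so the search range is large enough; the default value #|G| is
   only returned when y is not reachable from x. *)
Definition dist (x y : G) : nat := find (has_walk x y) (iota 0 #|{: G}|).

Definition boundary : {set G} :=
  if #|{: G}| == 1%N then [set: G]
  else [set v | [exists u : G,
         (deg v)%:R^-1 * (\sum_(w in nbhd v) (dist w u)%:R)
           < (dist v u)%:R :> rat]%R].

Definition beta2 (v u : G) : int :=
  (\sum_(w in nbhd v) ((dist v u)%:Z - (dist w u)%:Z))%R.

(* The default value is itself one of the terms, so this is the maximum even
   when all the terms are negative. *)
Definition beta (v : G) : int :=
  \big[Order.max/beta2 v v]_(u : G) beta2 v u.

Definition leaves : {set G} := [set v | deg v == 1%N].

Definition acyclic : Prop :=
  forall c : seq G, 2 < size c -> ~ ucycle edge c.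

Definition is_tree : Prop := connected G /\ acyclic.

Definition attach_set : {set G} := [set v in boundary | beta v == 1%R].

End Invariants.

Section SymGraph.

Variables (T : finType) (r : rel T).

Let sym_edge : rel T := [rel x y | (x != y) && (r x y || r y x)].

Fact sym_edge_sym : symmetric sym_edge.
Proof. by move=> x y; rewrite /sym_edge /= eq_sym orbC. Qed.

Fact sym_edge_irrefl : irreflexive sym_edge.
Proof. by move=> x; rewrite /sym_edge /= eqxx. Qed.

Definition sym_graph : sgraph := SGraph sym_edge_sym sym_edge_irrefl.

End SymGraph.

Definition path_graph (n : nat) : sgraph :=
  sym_graph [rel i j : 'I_n | j == i.+1 :> nat].

Definition cycle_graph (n : nat) : sgraph :=
  sym_graph [rel i j : 'I_n | j == i.+1 %% n :> nat].

Definition complete_graph (n : nat) : sgraph :=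
  sym_graph [rel i j : 'I_n | true].

(* None is the hub. *)
Definition cone (G : sgraph) : sgraph :=
  sym_graph (fun x y : option G =>
    match x, y with
    | Some u, Some v => edge u v
    | _, _ => true
    end).

Definition del_edge (G : sgraph) (a b : G) : sgraph :=
  sym_graph [rel x y : G |
    edge x y && ~~ ((x == a) && (y == b) || (x == b) && (y == a))].

(* A path of length l v is attached at every vertex v: the pair (v, 0) is the
   vertex v itself, and (v, i) with 0 < i <= l v is the i-th new vertex of the
   path attached at v. *)
Definition attach (G : sgraph) (l : G -> nat) : sgraph :=
  sym_graph (fun x y : {v : G & 'I_(l v).+1} =>
    [&& tagged x == 0 :> nat, tagged y == 0 :> nat & edge (tag x) (tag y)]
    || (tag x == tag y) && (tagged y == (tagged x).+1 :> nat)).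

Definition is_tripod (G : sgraph) : Prop :=
  exists l : complete_graph 3 -> nat, isomorphic G (attach l).

Definition obtained_from (H G : sgraph) : Prop :=
  exists l : H -> nat,
    (forall v, v \notin attach_set H -> l v = 0) /\ isomorphic G (attach l).

(* The vertices inr 0, ..., inr k form the path from m = inr 0 to m' = inr k,
   and a, b, c, d are inl 0, inl 1, inl 2, inl 3. The vertices c and d are
   adjacent exactly when cd is true. *)
Definition double_fork (cd : bool) (k : nat) : sgraph :=
  sym_graph (fun x y : 'I_4 + 'I_k.+1 =>
    match x, y with
    | inl i, inl j =>
        (i == 0 :> nat) && (j == 1 :> nat)
        || [&& cd, i == 2 :> nat & j == 3 :> nat]
    | inl i, inr t => if i < 2 then t == 0 :> nat else t == k :> nat
    | inr s, inr t => t == s.+1 :> nat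
    | inr _, inl _ => false
    end).

Definition H1 : sgraph := cone (cycle_graph 4).
Definition H2 : sgraph := cycle_graph 4.
Definition H3 : sgraph := complete_graph 4.
Definition H4 : sgraph :=
  @del_edge H1 (Some (@Ordinal 4 0 isT)) (Some (@Ordinal 4 1 isT)).
Definition H5 : sgraph :=
  @del_edge H3 (@Ordinal 4 0 isT) (@Ordinal 4 1 isT).
Definition H6 (k : nat) : sgraph := double_fork true k.
Definition H7 (k : nat) : sgraph := double_fork false k.

(* Main.v *)
Require Import Defs.
From mathcomp Require Import all_boot all_order all_algebra zify.

(* Removing a leaf changes the boundary in a controlled way, so it suffices to
   classify the leafless graphs whose boundary lies in {b1, b2, b3, b4}. Every
   geodesic extends to a boundary vertex, hence x |-> (d(x, b1), ..., d(x, b4))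
   is an isometric embedding into the sup norm whose image lies in the tight
   span of the four points: a rectangle with four legs, of length at most 1/2
   when there is no leaf. If d(b1,b2) + d(b3,b4) is the largest of the three
   pairing sums, a non-boundary x satisfies d(x,b1) + d(x,b2) = d(b1,b2) and
   d(x,b3) + d(x,b4) = d(b3,b4), and at x each distance d(-, bi) has at least as
   many larger as smaller neighbouring values. On a side of a nondegenerate
   rectangle this determines the neighbours of x, and either x is a cut vertex,
   which would make the rectangle degenerate, or the graph is H4. Without such
   x the graph is H1, H2 or H5; a degenerate rectangle gives K3, K4 or H6. *)

Set Implicit Arguments.
Unset Strict Implicit.
Unset Printing Implicit Defensive.

Import Order.TTheory GRing.Theory Num.Theory.

(** * Distances and the boundary *)

(** Call the number of neighbours of v closer to u minus the number of farther ones the excess of v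
    towards u. This is [beta2 v u], and v is in the boundary iff some excess is positive. A leaf b
    at c changes no distance between other vertices; it only gives c one more farther neighbour
    towards every target except b. So if the largest excess of c was 1, b replaces c in the
    boundary, and otherwise b is a new boundary vertex. This is why paths are attached exactly where
    beta is 1. A leaf placed on a leg of a tripod before its end is the only step that creates a new
    graph that is not a tree, which is the origin of H7, the family absent from the leafless list.
    In the leafless case coordinates control one vertex and its neighbours; large rectangles need a
    global argument. It is that a nonboundary vertex x with a neighbour y, the other neighbours
    being pairwise adjacent, separates what x sees through y from everything else. *)

Ltac slia :=
  repeat match goal with
  | H := _ |- _ => clear H
  | H : is_true (~~ (_ == _)) |- _ => clear H
  | H : is_true (edge _ _) |- _ => clear H
  | H : forall _, _ |- _ => clear H
  end; lia.

Section Walks.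

Variable G : sgraph.
Implicit Types (x y z : G).

Lemma has_walkP x y n :
  reflect (exists p : seq G, [/\ path edge x p, last x p = y & size p = n])
          (has_walk x y n).
Proof.
apply: (iffP existsP) => [[p /andP[pp /eqP lp]]|[p [pp lp sp]]].
  by exists p; rewrite size_tuple.
have sp' : size p == n by apply/eqP.
by exists (Tuple sp'); rewrite pp lp eqxx.
Qed.

Lemma dist_has_walk x y : connect edge x y -> has_walk x y (dist x y).
Proof.
case/connectP=> p pp ->; case/shortenP: pp => q qp qu _.
have sq : size q < #|{: G}|.
  by move: (max_card (mem (x :: q))); rewrite (card_uniqP qu).
have : has (has_walk x (last x q)) (iota 0 #|{: G}|).
  apply/hasP; exists (size q); first by rewrite mem_iota.
  by apply/has_walkP; exists q.
move=> hs; move: (nth_find 0 hs); rewrite nth_iota ?add0n //.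
by rewrite -{2}(size_iota 0 #|{: G}|) -has_find.
Qed.

Lemma dist_le x y n : has_walk x y n -> dist x y <= n.
Proof.
move=> wn; rewrite leqNgt; apply/negP => lt_n.
have lt_nG : n < #|{: G}|.
  by apply: (leq_trans lt_n); rewrite -(size_iota 0 #|{: G}|) find_size.
by move: (before_find 0 lt_n); rewrite nth_iota // wn.
Qed.

(** Descending along the steps gives a walk of length [D x], and no walk is shorter because an edge
    lowers [D] by at most one. Connectedness to [y] comes out of the descent, so this certifies
    explicit distance formulas. *)
Lemma dist_unique y (D : G -> nat) :
  D y = 0 -> (forall x z, edge x z -> D x <= (D z).+1) ->
  (forall x, x != y -> exists2 z, edge x z & D x = (D z).+1) ->
  forall x, dist x y = D x.
Proof.
move=> Dy Dedge Dstep x.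
have walk n : forall z, D z = n -> has_walk z y n.
  elim: n => [|n IHn] z Dz.
    have [<-|/Dstep[w _]] := eqVneq z y; last by rewrite Dz.
    by apply/has_walkP; exists [::].
  have [zy|/Dstep[w zw]] := eqVneq z y; first by move: Dz; rewrite zy Dy.
  rewrite Dz => -[/esym/IHn/has_walkP[p [pp lp sp]]].
  by apply/has_walkP; exists (w :: p); rewrite /= zw pp sp.
have le_walk p : forall z, path edge z p -> last z p = y -> D z <= size p.
  elim: p => [z _ /= ->|w p IHp z /= /andP[zw wp] lp]; first by rewrite Dy.
  by apply: leq_trans (Dedge _ _ zw) _; rewrite ltnS IHp.
have wx := walk _ x erefl.
apply/eqP; rewrite eqn_leq dist_le //=.
have cxy : connect edge x y.
  by case/has_walkP: wx => p [pp <- _]; apply/connectP; exists p.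
by case/has_walkP: (dist_has_walk cxy) => p [pp lp <-]; apply: le_walk.
Qed.

End Walks.

Section Distance.

Variable G : sgraph.
Hypothesis connG : connected G.
Implicit Types (x y z u v w : G).

Let conn x y : connect edge x y := connG.2 x y.

Lemma dist0 x : dist x x = 0.
Proof. by apply/eqP; rewrite -leqn0; apply: dist_le; apply/has_walkP; exists [::]. Qed.

Lemma dist_eq0 x y : (dist x y == 0) = (x == y).
Proof.
apply/eqP/eqP => [d0|->]; last exact: dist0.
by move: (dist_has_walk (conn x y)); rewrite d0 => /has_walkP[[|? ?] []].
Qed.

Lemma dist_triangle x y z : dist x z <= dist x y + dist y z.
Proof.
case/has_walkP: (dist_has_walk (conn x y)) => p [pp lp sp].
case/has_walkP: (dist_has_walk (conn y z)) => q [pq lq sq].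
apply: dist_le; apply/has_walkP; exists (p ++ q).
by rewrite cat_path pp lp pq last_cat lp lq size_cat sp sq.
Qed.

Lemma dist_edge_le x y : edge x y -> dist x y <= 1.
Proof. by move=> xy; apply: dist_le; apply/has_walkP; exists [:: y]; rewrite /= xy. Qed.

Lemma dist_step x y : x != y -> exists2 z, edge x z & dist x y = (dist z y).+1.
Proof.
move=> neq_xy; case/has_walkP: (dist_has_walk (conn x y)) => -[|z p] [/=].
  by move=> _ xy; rewrite xy eqxx in neq_xy.
move=> /andP[xz pp] lp sp; exists z => //.
have dzy : dist z y <= size p by apply: dist_le; apply/has_walkP; exists p.
by move: (dist_triangle x z y) (dist_edge_le xz); lia.
Qed.

Lemma dist_sym x y : dist x y = dist y x.
Proof.
have half u v : dist u v <= dist v u.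
  case/has_walkP: (dist_has_walk (conn v u)) => p [pp lp sp].
  apply: dist_le; apply/has_walkP; exists (rev (belast v p)).
  rewrite -{}lp in sp *; rewrite rev_path size_rev size_belast sp; split=> //.
    by rewrite -(eq_path (e := edge)) // => a b /=; rewrite edge_sym.
  by case: (p) => //= a p'; rewrite rev_cons last_rcons.
by apply/eqP; rewrite eqn_leq !half.
Qed.

Lemma dist_gt0 x y : (0 < dist x y) = (x != y).
Proof. by rewrite lt0n dist_eq0. Qed.

Lemma edge_neq x y : edge x y -> x != y.
Proof. by move=> xy; apply/eqP => eq_xy; rewrite eq_xy edge_irrefl in xy. Qed.

Lemma dist_eq1 x y : (dist x y == 1) = edge x y.
Proof.
apply/eqP/idP => [d1|xy].
  have neq_xy : x != y by rewrite -dist_gt0 d1.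
  have [z xz] := dist_step neq_xy; rewrite d1 => -[/esym/eqP].
  by rewrite dist_eq0 => /eqP <-.
by apply/eqP; rewrite eqn_leq dist_edge_le // dist_gt0 edge_neq.
Qed.

Lemma edge_dist1 x y : edge x y -> dist x y = 1.
Proof. by rewrite -dist_eq1 => /eqP. Qed.

Lemma dist_edge_r x y u : edge x y -> dist x u <= (dist y u).+1.
Proof. by move=> xy; move: (dist_triangle x y u) (edge_dist1 xy); lia. Qed.

(** Along an edge the distance to [u] changes by at most one, so these two counts determine the sums
    in [beta2] and in the definition of the boundary. *)
Definition closer v u := #|[set w in nbhd v | dist w u < dist v u]|.
Definition farther v u := #|[set w in nbhd v | dist v u < dist w u]|.

Lemma sum_nbhd_pred v (P : pred G) :
  (\sum_(w in nbhd v) (P w : nat)%:Z)%R = (#|[set w in nbhd v | P w]|)%:Z%R.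
Proof.
have -> : #|[set w in nbhd v | P w]| = \sum_(w in nbhd v) P w.
  rewrite -sum1_card big_mkcond [RHS]big_mkcond; apply: eq_bigr => w _.
  by rewrite !inE; case: (edge v w); case: (P w).
by rewrite (big_morph Posz (id1 := 0%R) (op1 := +%R)).
Qed.

Lemma beta2E v u : beta2 v u = ((closer v u)%:Z - (farther v u)%:Z)%R.
Proof.
rewrite /closer /farther -!sum_nbhd_pred -sumrB /beta2.
apply: eq_bigr => w; rewrite inE => vw.
move: (dist_edge_r u vw); rewrite edge_sym in vw; move: (dist_edge_r u vw).
by case: (ltngtP (dist w u) (dist v u)) => /=; lia.
Qed.

Lemma exists_neq v : 1 < #|{: G}| -> exists u, v != u.
Proof.
move=> G_gt1; have : 0 < #|predC1 v| by rewrite cardC1; case: #|_| G_gt1 => [|[]].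
by case/card_gt0P => u; rewrite !inE eq_sym; exists u.
Qed.

Lemma deg_gt0 v : 1 < #|{: G}| -> 0 < deg v.
Proof.
case/(exists_neq v) => u /dist_step[z vz _].
by apply/card_gt0P; exists z; rewrite inE.
Qed.

(** Multiplying the inequality between averages by the positive degree turns it into positivity of
    [beta2 v u]. *)
Lemma boundaryP v :
  1 < #|{: G}| -> reflect (exists u, farther v u < closer v u) (v \in boundary G).
Proof.
move=> G_gt1; rewrite /boundary; case: eqP => [G1|_]; first by rewrite G1 in G_gt1.
rewrite inE; apply: (iffP existsP) => -[u Hu]; exists u; move: Hu.
all: have dv : (0 < (deg v)%:R :> rat)%R by rewrite ltr0n deg_gt0.
all: rewrite mulrC ltr_pdivrMr // -natrM -natr_sum ltr_nat.
all: have := beta2E v u; rewrite /beta2 sumrB sumr_const -/(deg v).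
all: rewrite -(big_morph Posz (id1 := 0%R) (op1 := +%R) (id2 := 0) (op2 := addn)) //.
all: rewrite -mulr_natr natz; move: (closer v u) (farther v u) => a b; lia.
Qed.

Lemma boundaryPn v u : 1 < #|{: G}| -> v \notin boundary G -> closer v u <= farther v u.
Proof. by move=> G_gt1; apply: contraR; rewrite -ltnNge => ?; apply/boundaryP => //;
  exists u. Qed.

Lemma closer_self v : closer v v = 0.
Proof.
by apply/eqP; rewrite cards_eq0; apply/eqP/setP => w; rewrite !inE dist0 ltn0 andbF.
Qed.

Lemma closer_gt0 v u : v != u -> 0 < closer v u.
Proof.
case/dist_step => z vz duz; apply/card_gt0P; exists z.
by rewrite !inE vz duz ltnSn.
Qed.

(* Moving away from x as long as possible ends in the boundary. *)
Lemma geodesic_extension x y : 1 < #|{: G}| ->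
  exists2 b, b \in boundary G & dist x b = dist x y + dist y b.
Proof.
move=> G_gt1; pose P z := dist x z == dist x y + dist y z.
have Py : P y by rewrite /P dist0 addn0.
case: (arg_maxnP (fun z => dist x z) Py) => z /eqP Pz z_max.
exists z => //; apply/(boundaryP z G_gt1); exists x.
suff -> : farther z x = 0.
  apply: closer_gt0; apply/eqP => zx; move: Pz z_max; rewrite zx dist0.
  move=> d0; have /eqP: dist x y = 0 by lia.
  rewrite dist_eq0 => /eqP xy z_max.
  have [u] := exists_neq x G_gt1; rewrite -dist_gt0.
  by have := z_max u; rewrite /P -xy dist0 add0n eqxx => /(_ isT); lia.
apply/eqP; rewrite cards_eq0; apply/eqP/setP => w; rewrite !inE.
apply/negP => /andP[zw lt_zw].
have := z_max w; rewrite /P.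
have := dist_edge_r y zw; rewrite edge_sym in zw; have := dist_edge_r y zw.
have := dist_edge_r x zw; have := dist_triangle x y w.
rewrite !(dist_sym _ x) !(dist_sym _ y) in lt_zw Pz *; lia.
Qed.

End Distance.

(** * Recognising the small graphs *)

Lemma isomorphic_inv (G H : sgraph) (f : H -> G) :
  injective f -> (forall x, exists a, f a = x) -> {mono f : a b / edge a b} ->
  isomorphic G H.
Proof.
move=> f_inj f_surj f_mono; have ex x : exists a, f a == x.
  by have [a <-] := f_surj x; exists a.
pose g x := xchoose (ex x).
have gK : cancel g f by move=> x; apply/eqP/(xchooseP (ex x)).
have fK : cancel f g by move=> a; apply: f_inj; rewrite gK.
by exists g; [exists f | move=> x y; rewrite -f_mono !gK].
Qed.

(** The zeros of the table [D] give injectivity and its ones give the edges, so a small graph is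
    recognised by comparing distance tables. *)
Lemma isomorphic_dist (G H : sgraph) (D : H -> H -> nat) (f : H -> G) :
  connected G -> (forall a b, (D a b == 0) = (a == b)) ->
  (forall a b, (D a b == 1) = edge a b) ->
  (forall x, exists a, f a = x) -> (forall a b, dist (f a) (f b) = D a b) ->
  isomorphic G H.
Proof.
move=> connG D0 D1 f_surj fD; apply: (isomorphic_inv (f := f)) => //.
  by move=> a b eq_ab; apply/eqP; rewrite -D0 -fD eq_ab dist0.
by move=> a b; rewrite -D1 -fD dist_eq1.
Qed.

Definition pick4 (T : Type) (a0 a1 a2 a3 : T) (i : nat) : T :=
  match i with 0 => a0 | 1 => a1 | 2 => a2 | _ => a3 end.

(** This table serves both for the 4-cycle and for the rim of the wheel: the hub does not bring
    opposite rim vertices closer than 2. *)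
Definition rim_dist (i j : nat) : nat := if i == j then 0 else if odd (i + j) then 1 else 2.

Definition wheel_dist (D : nat -> nat -> nat) (a b : option 'I_4) : nat :=
  match a, b with
  | None, None => 0
  | Some i, Some j => D i j
  | _, _ => 1
  end.

Definition wheel_map (T : Type) (x a0 a1 a2 a3 : T) (a : option 'I_4) : T :=
  if a is Some i then pick4 a0 a1 a2 a3 i else x.

Definition cut_rim_dist (i j : nat) : nat :=
  if (i == 0) && (j == 1) || (i == 1) && (j == 0) then 2 else rim_dist i j.

(** For distinct indices, [i + j == 1] singles out the deleted edge between 0 and 1. *)
Definition diamond_dist (i j : nat) : nat :=
  if i == j then 0 else if i + j == 1 then 2 else 1.

Ltac ord4_cases i := case: i => [[|[|[|[|?]]]] ?] //.

Lemma wheel_surj (T : Type) (x a0 a1 a2 a3 y : T) :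
  y = x \/ y = a0 \/ y = a1 \/ y = a2 \/ y = a3 ->
  exists a, wheel_map x a0 a1 a2 a3 a = y.
Proof.
case=> [->|[->|[->|[->|->]]]]; first by exists None.
- by exists (Some (@Ordinal 4 0 isT)).
- by exists (Some (@Ordinal 4 1 isT)).
- by exists (Some (@Ordinal 4 2 isT)).
- by exists (Some (@Ordinal 4 3 isT)).
Qed.

Lemma pick4_surj (T : Type) (a0 a1 a2 a3 y : T) :
  y = a0 \/ y = a1 \/ y = a2 \/ y = a3 ->
  exists i : 'I_4, pick4 a0 a1 a2 a3 i = y.
Proof.
case=> [->|[->|[->|->]]].
- by exists (@Ordinal 4 0 isT).
- by exists (@Ordinal 4 1 isT).
- by exists (@Ordinal 4 2 isT).
- by exists (@Ordinal 4 3 isT).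
Qed.

Section Isos.

Variable G : sgraph.
Hypothesis connG : connected G.
Notation d := (@dist G).

Lemma iso_H1 (x a0 a1 a2 a3 : G) :
  (forall y, y = x \/ y = a0 \/ y = a1 \/ y = a2 \/ y = a3) ->
  d x a0 = 1 -> d x a1 = 1 -> d x a2 = 1 -> d x a3 = 1 ->
  d a0 a1 = 1 -> d a1 a2 = 1 -> d a2 a3 = 1 -> d a0 a3 = 1 ->
  d a0 a2 = 2 -> d a1 a3 = 2 -> isomorphic G H1.
Proof.
move=> cov *.
apply: (@isomorphic_dist G H1 (wheel_dist rim_dist) (wheel_map x a0 a1 a2 a3) connG).
- by case=> [i|] [j|] //; ord4_cases i; ord4_cases j.
- by case=> [i|] [j|] //; ord4_cases i; ord4_cases j.
- by move=> y; apply: wheel_surj.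
case=> [i|] [j|]; rewrite ?dist0 //.
- by ord4_cases i; ord4_cases j; rewrite /= ?dist0 // dist_sym.
- by ord4_cases i; rewrite /= dist_sym.
- by ord4_cases j.
Qed.

Lemma iso_H4 (x a0 a1 a2 a3 : G) :
  (forall y, y = x \/ y = a0 \/ y = a1 \/ y = a2 \/ y = a3) ->
  d x a0 = 1 -> d x a1 = 1 -> d x a2 = 1 -> d x a3 = 1 ->
  d a0 a1 = 2 -> d a1 a2 = 1 -> d a2 a3 = 1 -> d a0 a3 = 1 ->
  d a0 a2 = 2 -> d a1 a3 = 2 -> isomorphic G H4.
Proof.
move=> cov *.
apply: (@isomorphic_dist G H4 (wheel_dist cut_rim_dist) (wheel_map x a0 a1 a2 a3) connG).
- by case=> [i|] [j|] //; ord4_cases i; ord4_cases j.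
- by case=> [i|] [j|] //; ord4_cases i; ord4_cases j.
- by move=> y; apply: wheel_surj.
case=> [i|] [j|]; rewrite ?dist0 //.
- by ord4_cases i; ord4_cases j; rewrite /= ?dist0 // dist_sym.
- by ord4_cases i; rewrite /= dist_sym.
- by ord4_cases j.
Qed.

Lemma iso_H2 (a0 a1 a2 a3 : G) :
  (forall y, y = a0 \/ y = a1 \/ y = a2 \/ y = a3) ->
  d a0 a1 = 1 -> d a1 a2 = 1 -> d a2 a3 = 1 -> d a0 a3 = 1 ->
  d a0 a2 = 2 -> d a1 a3 = 2 -> isomorphic G H2.
Proof.
move=> cov *.
apply: (@isomorphic_dist G H2 rim_dist (pick4 a0 a1 a2 a3) connG).
- by move=> i j; ord4_cases i; ord4_cases j.
- by move=> i j; ord4_cases i; ord4_cases j.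
- by move=> y; apply: pick4_surj.
by move=> i j; ord4_cases i; ord4_cases j; rewrite /= ?dist0 // dist_sym.
Qed.

Lemma iso_H5 (a0 a1 a2 a3 : G) :
  (forall y, y = a0 \/ y = a1 \/ y = a2 \/ y = a3) ->
  d a0 a1 = 2 -> d a1 a2 = 1 -> d a2 a3 = 1 -> d a0 a3 = 1 ->
  d a0 a2 = 1 -> d a1 a3 = 1 -> isomorphic G H5.
Proof.
move=> cov *.
apply: (@isomorphic_dist G H5 diamond_dist (pick4 a0 a1 a2 a3) connG).
- by move=> i j; ord4_cases i; ord4_cases j.
- by move=> i j; ord4_cases i; ord4_cases j.
- by move=> y; apply: pick4_surj.
by move=> i j; ord4_cases i; ord4_cases j; rewrite /= ?dist0 // dist_sym.
Qed.

Lemma iso_H3 (a0 a1 a2 a3 : G) :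
  (forall y, y = a0 \/ y = a1 \/ y = a2 \/ y = a3) ->
  d a0 a1 = 1 -> d a1 a2 = 1 -> d a2 a3 = 1 -> d a0 a3 = 1 ->
  d a0 a2 = 1 -> d a1 a3 = 1 -> isomorphic G H3.
Proof.
move=> cov *.
apply: (@isomorphic_dist G H3 (fun i j => i != j) (pick4 a0 a1 a2 a3) connG).
- by move=> i j; ord4_cases i; ord4_cases j.
- by move=> i j; ord4_cases i; ord4_cases j.
- by move=> y; apply: pick4_surj.
by move=> i j; ord4_cases i; ord4_cases j; rewrite /= ?dist0 // dist_sym.
Qed.

Lemma iso_K3 (a0 a1 a2 : G) :
  (forall y, y = a0 \/ y = a1 \/ y = a2) ->
  d a0 a1 = 1 -> d a1 a2 = 1 -> d a0 a2 = 1 -> isomorphic G (complete_graph 3).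
Proof.
move=> cov *.
apply: (@isomorphic_dist G (complete_graph 3) (fun i j => i != j)
  (fun i => pick4 a0 a1 a2 a0 i) connG).
- by case=> [[|[|[|?]]] ?] [[|[|[|?]]] ?].
- by case=> [[|[|[|?]]] ?] [[|[|[|?]]] ?].
- move=> y; case: (cov y) => [->|[->|->]].
  + by exists (@Ordinal 3 0 isT).
  + by exists (@Ordinal 3 1 isT).
  + by exists (@Ordinal 3 2 isT).
by case=> [[|[|[|?]]] ?] [[|[|[|?]]] ?] //=; rewrite ?dist0 // dist_sym.
Qed.

End Isos.

(** * Distances in double forks *)

Ltac iflia := repeat (case: ifP => ?); lia.

Section Fork.

Variables (cd : bool) (k : nat).
Local Notation H := (double_fork cd k).

(** The level along the fork: a and b at 0, the path at 1 to k+1, c and d at k+2. Distinct vertices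
    share a level only in the pairs a, b and c, d; otherwise the distance is the difference of
    levels. *)
Definition fork_pos (x : 'I_4 + 'I_k.+1) : nat :=
  match x with inl i => if i < 2 then 0 else k.+2 | inr t => t.+1 end.

Definition fork_dist (x y : 'I_4 + 'I_k.+1) : nat :=
  if x == y then 0
  else if fork_pos x == fork_pos y then (if cd || (fork_pos x == 0) then 1 else 2)
  else (fork_pos x - fork_pos y) + (fork_pos y - fork_pos x).

Lemma fork_dist_eq0 (x y : H) : (fork_dist x y == 0) = (x == y).
Proof.
rewrite /fork_dist; case: (x == y) => //.
by case: ifP => [_|]; [case: ifP | lia].
Qed.

Lemma eq_inl (i j : 'I_4) : (inl i == inl j :> 'I_4 + 'I_k.+1) = (i == j :> nat).
Proof. by []. Qed.

Lemma eq_inr (i j : 'I_k.+1) : (inr i == inr j :> 'I_4 + 'I_k.+1) = (i == j :> nat).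
Proof. by []. Qed.

Lemma fork_dist_eq1 (x y : H) : (fork_dist x y == 1) = edge x y.
Proof.
rewrite /fork_dist /=; case: x y => [i|s] [j|t]; rewrite ?eq_inl ?eq_inr.
- by ord4_cases i; ord4_cases j; rewrite /= ?eqxx /=; case: (cd).
- by ord4_cases i; have := ltn_ord t; case: (cd) => /=; iflia.
- by ord4_cases j; have := ltn_ord s; case: (cd) => /=; iflia.
- by rewrite /=; case: (cd) => /=; iflia.
Qed.

Lemma fork_edge_le (x y z : H) : edge x z -> fork_dist x y <= (fork_dist z y).+1.
Proof.
rewrite -fork_dist_eq1 /fork_dist.
case: x y z => [i|s] [j|t] [l|u]; rewrite ?eq_inl ?eq_inr.
all: try ord4_cases i; try ord4_cases j; try ord4_cases l; rewrite /= ?eqxx ?orbT ?orbF /=.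
all: try have := ltn_ord s; try have := ltn_ord t; try have := ltn_ord u.
all: by case: (cd); iflia.
Qed.

Lemma fork_step (x y : H) : x != y ->
  exists2 z : H, edge x z & fork_dist x y = (fork_dist z y).+1.
Proof.
move=> xy.
have inordE n : n <= k -> (inord n : 'I_k.+1) = n :> nat by move=> nk; rewrite inordK.
suff [z] : exists z : H, (fork_dist x z == 1) && (fork_dist x y == (fork_dist z y).+1).
  by case/andP => xz /eqP e; exists z; rewrite -?fork_dist_eq1.
case: x y xy => [i|s] [j|t]; rewrite ?eq_inl ?eq_inr => xy.
- case: (boolP (fork_dist (inl i) (inl j) == 1)) => [e|ne].
    by exists (inl j); rewrite e /= /fork_dist eqxx; move: e; rewrite /fork_dist => /eqP->.
  exists (inr (inord (if i < 2 then 0 else k))).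
  rewrite /fork_dist /= !inordE; try by case: ifP.
  move: xy ne; rewrite /fork_dist ?eq_inl.
  by ord4_cases i; ord4_cases j; rewrite /= ?eqxx ?orbT ?orbF /=; case: (cd) => /=; iflia.
- clear xy; exists (inr (inord (if i < 2 then 0 else k))).
  rewrite /fork_dist ?eq_inr /= !inordE; try by case: ifP.
  by ord4_cases i; have := ltn_ord t; rewrite /= ; case: (cd) => /=; iflia.
- clear xy; have [e|ne] := boolP (fork_dist (inr s : H) (inl j) == 1).
    by exists (inl j); rewrite e /= /fork_dist eqxx; move: e; rewrite /fork_dist => /eqP->.
  exists (inr (inord (if j < 2 then s.-1 else s.+1))).
  move: ne; have := ltn_ord s => sk; rewrite /fork_dist ?eq_inr /=.
  ord4_cases j => /= ne; rewrite ?eq_inr inordE; move: ne; case: (cd); iflia.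
- have {}xy : s != t :> nat := xy.
  have := ltn_ord s; have := ltn_ord t => tk sk.
  have [ts|ts] := ltnP t s; [exists (inr (inord s.-1)) | exists (inr (inord s.+1))].
  all: rewrite /fork_dist !eq_inr /= inordE; last by lia.
  all: by case: (cd); iflia.
Qed.

Lemma dist_fork (x y : H) : dist x y = fork_dist x y.
Proof.
apply: (@dist_unique H y (fun x => fork_dist x y)); first by rewrite /fork_dist eqxx.
- by move=> a b; apply: fork_edge_le.
- by move=> a; apply: fork_step.
Qed.

End Fork.

(** * Leafless graphs *)

Section Leafless.

Variable G : sgraph.
Hypothesis connG : connected G.
Implicit Types (x y z u v w : G).

Notation d := (@dist G).

Let dC x y : d x y = d y x := dist_sym connG x y.
Let d0 x : d x x = 0 := dist0 x.
Let d1 x y : edge x y -> d x y = 1 := @edge_dist1 G connG x y.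

Lemma dist1_edge x y : d x y = 1 -> edge x y.
Proof. by move=> dxy; rewrite -(dist_eq1 connG) dxy. Qed.

Lemma dist0_eq x y : d x y = 0 -> x = y.
Proof. by move=> dxy; apply/eqP; rewrite -(dist_eq0 connG) dxy. Qed.

Lemma dist_tri3 a b x :
  d a b <= d x a + d x b /\ d x a <= d x b + d a b /\ d x b <= d x a + d a b.
Proof.
have := dist_triangle connG a x b; have := dist_triangle connG x b a.
by have := dist_triangle connG x a b; rewrite (dC a x) (dC b a); lia.
Qed.

Lemma dist_edge_both x w u : edge x w -> d x u <= d w u + 1 /\ d w u <= d x u + 1.
Proof. by move/d1 => xw; have := dist_tri3 x w u; have := dC u x; have := dC u w; lia. Qed.

(** Only an inclusion, so that boundaries with fewer than four vertices fit: the list may have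
    repetitions and vertices outside the boundary. *)
Definition covers (b1 b2 b3 b4 : G) : Prop :=
  forall v, v \in boundary G -> v = b1 \/ v = b2 \/ v = b3 \/ v = b4.

(** In the tight span such an [x] lies on the leg ending at [a]: it is on geodesics from [a] to all
    three other points. *)
Definition leg (a b c e x : G) : Prop :=
  d x a + d x b = d a b /\ d x a + d x c = d a c /\ d x a + d x e = d a e.

(** The pairing 12|34 has the largest of the three sums, so b1b2 and b3b4 are the diagonals of the
    rectangle in the tight span. *)
Definition frame (b1 b2 b3 b4 : G) : Prop :=
  covers b1 b2 b3 b4 /\
  d b1 b3 + d b2 b4 <= d b1 b2 + d b3 b4 /\
  d b1 b4 + d b2 b3 <= d b1 b2 + d b3 b4.

Lemma frame_swap12 b1 b2 b3 b4 : frame b1 b2 b3 b4 -> frame b2 b1 b3 b4.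
Proof.
by move=> [cov S]; split; [move=> v /cov; tauto | rewrite (dC b2 b1); lia].
Qed.

Lemma frame_swap34 b1 b2 b3 b4 : frame b1 b2 b3 b4 -> frame b1 b2 b4 b3.
Proof.
by move=> [cov S]; split; [move=> v /cov; tauto | rewrite (dC b4 b3); lia].
Qed.

Lemma frame_swap b1 b2 b3 b4 : frame b1 b2 b3 b4 -> frame b3 b4 b1 b2.
Proof.
move=> [cov S]; split; first by move=> v /cov; tauto.
by rewrite (dC b3 b1) (dC b4 b2) (dC b3 b2) (dC b4 b1); lia.
Qed.

Definition nondeg_frame (b1 b2 b3 b4 : G) : Prop :=
  d b1 b3 + d b2 b4 < d b1 b2 + d b3 b4 /\ d b1 b4 + d b2 b3 < d b1 b2 + d b3 b4.

Lemma nondeg_swap12 b1 b2 b3 b4 : nondeg_frame b1 b2 b3 b4 -> nondeg_frame b2 b1 b3 b4.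
Proof. by rewrite /nondeg_frame (dC b2 b1); lia. Qed.

Lemma nondeg_swap34 b1 b2 b3 b4 : nondeg_frame b1 b2 b3 b4 -> nondeg_frame b1 b2 b4 b3.
Proof. by rewrite /nondeg_frame (dC b4 b3); lia. Qed.

Lemma nondeg_swap b1 b2 b3 b4 : nondeg_frame b1 b2 b3 b4 -> nondeg_frame b3 b4 b1 b2.
Proof.
by rewrite /nondeg_frame (dC b3 b1) (dC b4 b2) (dC b3 b2) (dC b4 b1); lia.
Qed.

Hypothesis G_gt1 : 1 < #|{: G}|.
Hypothesis leafless : forall v w : G, edge v w -> exists2 w', edge v w' & w' != w.

Lemma cover_extension b1 b2 b3 b4 x y : covers b1 b2 b3 b4 ->
  d x b1 = d x y + d y b1 \/ d x b2 = d x y + d y b2 \/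
  d x b3 = d x y + d y b3 \/ d x b4 = d x y + d y b4.
Proof.
move=> cov; have [b /cov bb] := geodesic_extension connG x y G_gt1.
by move: bb => [->|[->|[->|->]]]; lia.
Qed.

(** The geodesic from [x] to [y] extends to a listed point, where equal distances force [d x y = 0].
    The four distances are thus coordinates. *)
Lemma cover_eq b1 b2 b3 b4 x y : covers b1 b2 b3 b4 ->
  d x b1 = d y b1 -> d x b2 = d y b2 -> d x b3 = d y b3 -> d x b4 = d y b4 -> x = y.
Proof. by move=> /(cover_extension x y) E *; apply: dist0_eq; lia. Qed.

(* The first vertex of such a leg would be the only neighbour of a. *)
Lemma leg_trivial a b c e x : covers a b c e -> leg a b c e x -> d x a = 0.
Proof.
move=> cov [Lb [Lc Le]]; apply/eqP; rewrite -leqn0 leqNgt; apply/negP => xa.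
have ax : a != x by rewrite -(dist_gt0 connG) dC.
have [w aw dax] := dist_step connG ax.
have [w' aw' ww'] := leafless aw.
suff /dist0_eq eq_ww' : d w w' = 0 by rewrite eq_ww' eqxx in ww'.
have E := cover_extension w w' cov.
have := d1 aw; have := d1 aw'; have := dC a w; have := dC a w'; have := dC x w; have := dC x a.
have := dist_tri3 x w b; have := dist_tri3 x w c; have := dist_tri3 x w e.
have := dist_tri3 a b w; have := dist_tri3 a c w; have := dist_tri3 a e w.
have := dist_tri3 a b w'; have := dist_tri3 a c w'; have := dist_tri3 a e w'.
have := dC b w; have := dC c w; have := dC e w; have := dC b x; have := dC c x; have := dC e x.
lia.
Qed.

Ltac quad a b c e x :=
  have := dist_tri3 a b x; have := dist_tri3 a c x; have := dist_tri3 a e x;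
  have := dist_tri3 b c x; have := dist_tri3 b e x; have := dist_tri3 c e x.

Ltac dsym6 a b c e :=
  have := dC a b; have := dC a c; have := dC a e;
  have := dC b c; have := dC b e; have := dC c e;
  have := d0 a; have := d0 b; have := d0 c; have := d0 e.

Ltac nbr b1 b2 b3 b4 xw :=
  have := dist_edge_both b1 xw; have := dist_edge_both b2 xw;
  have := dist_edge_both b3 xw; have := dist_edge_both b4 xw.

(** * Vertices off the four listed points lie on the rectangle *)

Section Frame.

Variables b1 b2 b3 b4 : G.
Hypothesis F : frame b1 b2 b3 b4.

Definition rect x : Prop := d x b1 + d x b2 = d b1 b2 /\ d x b3 + d x b4 = d b3 b4.

Definition inner x : Prop := 0 < d x b1 /\ 0 < d x b2 /\ 0 < d x b3 /\ 0 < d x b4.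

(** Join two listed points when [x] lies on a geodesic between them. Extending the geodesics from
    each listed point through [x] shows that none is isolated. A graph on four points without
    isolated points contains a perfect matching or is a star. A star is a leg, excluded by
    [leg_trivial]; a matching yields [rect]. *)
Lemma inner_rect x : inner x -> rect x.
Proof.
move=> [p1 [p2 [p3 p4]]].
have [cov S] := F.
have L1 : leg b1 b2 b3 b4 x -> d x b1 = 0 by apply: leg_trivial.
have L2 : leg b2 b1 b3 b4 x -> d x b2 = 0.
  by apply: leg_trivial => v /cov; tauto.
have L3 : leg b3 b1 b2 b4 x -> d x b3 = 0.
  by apply: leg_trivial => v /cov; tauto.
have L4 : leg b4 b1 b2 b3 x -> d x b4 = 0.
  by apply: leg_trivial => v /cov; tauto.
have := cover_extension b1 x cov; have := cover_extension b2 x cov.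
have := cover_extension b3 x cov; have := cover_extension b4 x cov.
rewrite !d0 (dC b1 x) (dC b2 x) (dC b3 x) (dC b4 x).
rewrite (dC b2 b1) (dC b3 b1) (dC b3 b2) (dC b4 b1) (dC b4 b2) (dC b4 b3) => E4 E3 E2 E1.
have [Q12 _] := dist_tri3 b1 b2 x; have [Q34 _] := dist_tri3 b3 b4 x.
(* By [S] the four distances from [x] add up to at most the two diagonals, so [Q12] and [Q34] are
   both tight. *)
have K13 : d x b1 + d x b3 = d b1 b3 -> d x b2 + d x b4 = d b2 b4 -> rect x.
  by rewrite /rect; lia.
have K14 : d x b1 + d x b4 = d b1 b4 -> d x b2 + d x b3 = d b2 b3 -> rect x.
  by rewrite /rect; lia.
have {}E1 : d x b1 + d x b2 = d b1 b2 \/ d x b1 + d x b3 = d b1 b3 \/ d x b1 + d x b4 = d b1 b4.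
  by clear -E1 p1; lia.
have {}E2 : d x b1 + d x b2 = d b1 b2 \/ d x b2 + d x b3 = d b2 b3 \/ d x b2 + d x b4 = d b2 b4.
  by clear -E2 p2; lia.
have {}E3 : d x b3 + d x b4 = d b3 b4 \/ d x b1 + d x b3 = d b1 b3 \/ d x b2 + d x b3 = d b2 b3.
  by clear -E3 p3; lia.
have {}E4 : d x b3 + d x b4 = d b3 b4 \/ d x b1 + d x b4 = d b1 b4 \/ d x b2 + d x b4 = d b2 b4.
  by clear -E4 p4; lia.
move: L1 L2 L3 L4; rewrite /leg (dC b2 b1) (dC b3 b1) (dC b3 b2) (dC b4 b1) (dC b4 b2) (dC b4
  b3).
rewrite !(addnC (d x b2) (d x b1)) !(addnC (d x b3) (d x b1)) !(addnC (d x b4) (d x b1)).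
rewrite !(addnC (d x b3) (d x b2)) !(addnC (d x b4) (d x b2)) !(addnC (d x b4) (d x b3)).
move: p1 p2 p3 p4 K13 K14; rewrite !lt0n /rect => /eqP p1 /eqP p2 /eqP p3 /eqP p4.
clear -E1 E2 E3 E4 p1 p2 p3 p4.
tauto.
Qed.

Lemma inner_or x : inner x \/ x = b1 \/ x = b2 \/ x = b3 \/ x = b4.
Proof.
have [/dist0_eq|p1] := posnP (d x b1); first by tauto.
have [/dist0_eq|p2] := posnP (d x b2); first by tauto.
have [/dist0_eq|p3] := posnP (d x b3); first by tauto.
by have [/dist0_eq|p4] := posnP (d x b4); [tauto | left].
Qed.

Lemma inner_notin x : inner x -> x \notin boundary G.
Proof.
move=> inx; apply/negP => /(F.1 x) E; move: inx; rewrite /inner.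
by case: E => [->|[->|[->|->]]]; rewrite d0; lia.
Qed.

Lemma inner_closer x u : inner x -> closer x u <= farther x u.
Proof. by move=> inx; apply: boundaryPn => //; apply: inner_notin. Qed.

Lemma inner_ex_farther x u : inner x -> x != u -> exists2 w, edge x w & d x u < d w u.
Proof.
move=> inx xu; have := leq_trans (closer_gt0 connG xu) (inner_closer u inx).
by case/card_gt0P => w; rewrite !inE => /andP[]; exists w.
Qed.

(** An inner vertex is outside the boundary, so one farther neighbour leaves room for one closer
    neighbour only. *)
Lemma inner_unique_closer x u : inner x ->
  (forall w w', edge x w -> edge x w' -> d x u < d w u -> d x u < d w' u -> w = w') ->
  forall w w', edge x w -> edge x w' -> d w u < d x u -> d w' u < d x u -> w = w'.
Proof.
move=> inx far w w' xw xw' lw lw'.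
have : farther x u <= 1.
  apply/card_le1_eqP => z z'; rewrite !inE => /andP[? ?] /andP[? ?].
  exact: far.
move/(leq_trans (inner_closer u inx))/card_le1_eqP; apply; rewrite !inE ?xw ?xw' //.
Qed.

(* Half-integral legs: the tight span of b1, ..., b4 is a rectangle with four
   legs of length at most 1/2. *)
Lemma half_leg : d b1 b3 + d b1 b4 <= d b3 b4 + 1.
Proof.
rewrite leqNgt; apply/negP => big; have [cov S] := F.
have [u neq_u] := exists_neq b1 G_gt1.
have [w bw _] := dist_step connG neq_u.
suff : leg b1 b2 b3 b4 w by move/(leg_trivial cov); rewrite dC d1.
have := d1 bw; rewrite /leg dC => wb.
quad b1 b2 b3 b4 w.
have [/inner_rect|E] := inner_or w; first by rewrite /rect; lia.
by move: E wb S; do 3?[case=> [->|]]; [| | |move->]; rewrite ?d0; dsym6 b1 b2 b3 b4; lia.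
Qed.

(* The vertices closer to y than x are separated from the others by x; a cut
   vertex would make two of the three pairings of the frame have equal sums. *)
Lemma no_clique_neighbourhood x y : nondeg_frame b1 b2 b3 b4 -> inner x -> edge x y ->
  (forall z z', edge x z -> edge x z' -> z != y -> z' != y -> z != z' -> edge z z') ->
  False.
Proof.
move=> [ND1 ND2] inx xy clique.
(* Some neighbour is farther from [u] than [x]. It cannot be adjacent to [z], and by the clique
   hypothesis only [y] escapes that. *)
have y_farther z u : edge x z -> z != y -> d z u < d x u -> d x u < d y u.
  move=> xz zy zu.
  have xu : x != u by rewrite -(dist_gt0 connG); lia.
  have [w xw wu] := inner_ex_farther inx xu.
  have [<- //|wy] := eqVneq w y.
  have [zw|zw] := eqVneq z w; first by rewrite zw in zu; lia.
  by have := dist_edge_both u (clique _ _ xz xw zy wy zw); lia.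
(* [U] is what [x] sees through [y]; by [U_closed] an edge leaving [U] can only end at [x]. *)
pose U u := d y u < d x u.
have U_closed u w : U u -> edge u w -> w != x -> U w.
  move=> Uu uw wx; rewrite /U ltnNge; apply/negP => nUw.
  have [z xz dxw] : exists2 z, edge x z & d x w = (d z w).+1.
    by apply: (dist_step connG); rewrite eq_sym.
  have zy : z != y by apply/eqP => zy; rewrite zy in dxw; lia.
  have zw : d z w < d x w by lia.
  have := y_farther _ _ xz zy zw.
  have := dist_edge_both y uw; have := dist_edge_both x uw; have := dist_edge_both z uw.
  have := dC u x; have := dC u y; have := dC u z; have := dC w x; have := dC w y;
    have := dC w z.
  have := y_farther _ u xz zy; rewrite /U in Uu; lia.
have U_sep n : forall u v, d u v <= n -> U u -> ~~ U v -> d u v = d u x + d x v.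
  elim: n => [|n IHn] u v duv Uu nUv.
    have /dist0_eq uv : d u v = 0 by lia.
    by rewrite -uv Uu in nUv.
  have uv : u != v by apply: contraNneq nUv => <-.
  have [w uw dw] := dist_step connG uv.
  have [wx|wx] := eqVneq w x; first by rewrite wx in uw dw; have := d1 uw; lia.
  have := IHn w v _ (U_closed _ _ Uu uw wx) nUv.
  by have := dist_edge_both x uw; have := dist_tri3 u v x; have := dC x u; have := dC x v; lia.
have sep u v : U u -> ~~ U v -> d x u + d x v = d u v.
  by move=> Uu nUv; rewrite (dC x u) -(U_sep (d u v) u v).
have [cov S] := F.
have exU : U b1 \/ U b2 \/ U b3 \/ U b4.
  by have := cover_extension x y cov; rewrite (d1 xy) /U; lia.
have exN : ~~ U b1 \/ ~~ U b2 \/ ~~ U b3 \/ ~~ U b4.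
  have [z xz zy] := leafless xy.
  have := cover_extension x z cov; rewrite (d1 xz) /U.
  have := y_farther z b1 xz zy; have := y_farther z b2 xz zy.
  by have := y_farther z b3 xz zy; have := y_farther z b4 xz zy; lia.
have L1 : leg b1 b2 b3 b4 x -> d x b1 = 0 by apply: leg_trivial.
have L2 : leg b2 b1 b3 b4 x -> d x b2 = 0.
  by apply: leg_trivial => v /cov; tauto.
have L3 : leg b3 b1 b2 b4 x -> d x b3 = 0.
  by apply: leg_trivial => v /cov; tauto.
have L4 : leg b4 b1 b2 b3 x -> d x b4 = 0.
  by apply: leg_trivial => v /cov; tauto.
move: inx L1 L2 L3 L4 exU exN; rewrite /inner /leg.
have {}sep u v : U u (+) U v -> d x u + d x v = d u v.
  by case Uu: (U u); case Uv: (U v) => // _; [|rewrite addnC (dC u v)]; apply: sep;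
    rewrite ?Uu ?Uv.
move: (sep b1 b2) (sep b1 b3) (sep b1 b4) (sep b2 b3) (sep b2 b4) (sep b3 b4).
have := dist_tri3 b1 b2 x; have := dist_tri3 b3 b4 x; dsym6 b1 b2 b3 b4.
clear -ND1 ND2.
(* One listed point against three puts [x] on a leg, which [leg_trivial] forbids off its end; two
   against two contradicts [ND1] or [ND2]. *)
case: (U b1); case: (U b2); case: (U b3); case: (U b4) => /=; lia.
Qed.

End Frame.
(** Each slack is twice the length of a leg, hence 0 or 1. *)
Lemma half_legs (b1 b2 b3 b4 : G) : frame b1 b2 b3 b4 ->
  (d b3 b4 <= d b1 b3 + d b1 b4 <= d b3 b4 + 1 /\
   d b3 b4 <= d b2 b3 + d b2 b4 <= d b3 b4 + 1) /\
  (d b1 b2 <= d b1 b3 + d b2 b3 <= d b1 b2 + 1 /\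
   d b1 b2 <= d b1 b4 + d b2 b4 <= d b1 b2 + 1).
Proof.
move=> F; have := half_leg F.
have := half_leg (frame_swap12 F).
have := half_leg (frame_swap F).
have := half_leg (frame_swap12 (frame_swap F)).
have := dist_tri3 b3 b4 b1; have := dist_tri3 b3 b4 b2.
have := dist_tri3 b1 b2 b3; have := dist_tri3 b1 b2 b4.
by dsym6 b1 b2 b3 b4; lia.
Qed.

(** * Inner vertices on a side of a nondegenerate rectangle *)

Section Side.

Variables b1 b2 b3 b4 x : G.
Hypothesis F : frame b1 b2 b3 b4.
Hypothesis ND : nondeg_frame b1 b2 b3 b4.
Hypothesis inx : inner b1 b2 b3 b4 x.
Hypothesis side : d x b2 + d x b4 = d b2 b4.

Let cov : covers b1 b2 b3 b4 := F.1.

(** A neighbour leaves the rectangle only by being a listed point whose leg has length 1/2, which is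
    the excess 1 in the equations. The position of [x] on the side leaves only its two ends for
    this. *)
Lemma side_nbr w : edge x w -> rect b1 b2 b3 b4 w \/
  (w = b2 /\ d b2 b3 + d b2 b4 = d b3 b4 + 1) \/
  (w = b4 /\ d b1 b4 + d b2 b4 = d b1 b2 + 1).
Proof.
move=> xw; have H := half_legs F; have [_ S] := F; have R := inner_rect F inx.
have [/(inner_rect F)|E] := inner_or b1 b2 b3 b4 w; first by left.
move: R ND inx side H S; rewrite /rect /nondeg_frame /inner; have := d1 xw.
quad b1 b2 b3 b4 x; dsym6 b1 b2 b3 b4.
case: E => [|[|[]]] -> *.
- by left; lia.
- by have [?|?] : d b2 b3 + d b2 b4 = d b3 b4 + 1 \/ d b2 b3 + d b2 b4 = d b3 b4 by [lia];
    [right; left | left; lia].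
- by left; lia.
- by have [?|?] : d b1 b4 + d b2 b4 = d b1 b2 + 1 \/ d b1 b4 + d b2 b4 = d b1 b2 by [lia];
    [right; right | left; lia].
Qed.

(** Moving away from [b1] leads towards [b2]. Unless [b2] is reached, this is a step along the side
    away from [b4], hence towards [b3], so all four coordinates are determined. *)
Lemma side_farther_unique w w' : edge x w -> edge x w' ->
  d x b1 < d w b1 -> d x b1 < d w' b1 -> w = w'.
Proof.
move=> xw xw' lw lw'; have R := inner_rect F inx.
have main z : edge x z -> d x b1 < d z b1 ->
  d z b2 + 1 = d x b2 /\ (z = b2 \/ rect b1 b2 b3 b4 z).
  move=> xz lz; have E := side_nbr xz; move: R ND inx side lz;
    rewrite /rect /nondeg_frame /inner.
  have := d1 xz; quad b1 b2 b3 b4 x; quad b1 b2 b3 b4 z; nbr b1 b2 b3 b4 xz; dsym6 b1 b2 b3 b4.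
  case: E => [|[[-> ?]|[-> ?]]]; rewrite ?/rect => *; split; try by lia.
  by left.
have [f2w Ew] := main _ xw lw; have [f2w' Ew'] := main _ xw' lw'.
case: Ew => [wb|Rw].
  by rewrite wb d0 in f2w; rewrite wb; apply/esym/dist0_eq; lia.
case: Ew' => [wb|Rw'].
  by rewrite wb d0 in f2w'; rewrite wb; apply/dist0_eq; lia.
move: Rw Rw' R side; rewrite /rect; quad b1 b2 b3 b4 w; quad b1 b2 b3 b4 w'.
nbr b1 b2 b3 b4 xw; nbr b1 b2 b3 b4 xw' => *.
by apply: (cover_eq cov); lia.
Qed.

Lemma side_closer_unique w w' : edge x w -> edge x w' ->
  d w b1 < d x b1 -> d w' b1 < d x b1 -> w = w'.
Proof.
by apply: (inner_unique_closer F inx); apply: side_farther_unique.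
Qed.

End Side.

Section SideHalf.

Variables b1 b2 b3 b4 x : G.
Hypothesis F : frame b1 b2 b3 b4.
Hypothesis ND : nondeg_frame b1 b2 b3 b4.
Hypothesis inx : inner b1 b2 b3 b4 x.
Hypothesis side : d x b2 + d x b4 = d b2 b4.

Let cov : covers b1 b2 b3 b4 := F.1.

Let F' : frame b3 b4 b1 b2 := frame_swap F.
Let ND' : nondeg_frame b3 b4 b1 b2.
Proof. by move: ND; rewrite /nondeg_frame; dsym6 b1 b2 b3 b4; slia. Qed.
Let inx' : inner b3 b4 b1 b2 x.
Proof. by move: inx; rewrite /inner; slia. Qed.
Let side' : d x b4 + d x b2 = d b4 b2.
Proof. by rewrite addnC side dC. Qed.

(** Exchanging the two diagonals gives the same uniqueness for [b3] as for [b1]. A neighbour that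
    keeps both distances would share all four coordinates with [x], so the at most four named
    vertices are all the neighbours. *)
Lemma side_nbrs : exists p m p3 m3,
  [/\ [/\ edge x p, edge x m, edge x p3 & edge x m3],
      d p b1 = d x b1 + 1 /\ d m b1 + 1 = d x b1,
      d p3 b3 = d x b3 + 1 /\ d m3 b3 + 1 = d x b3 &
      forall w, edge x w ->
        [/\ d x b1 < d w b1 -> w = p, d w b1 < d x b1 -> w = m,
            d x b3 < d w b3 -> w = p3, d w b3 < d x b3 -> w = m3 &
            w = p \/ w = m \/ w = p3 \/ w = m3]].
Proof.
have [n1 n2 [n3 n4]] : [/\ x != b1, x != b2 & x != b3 /\ x != b4].
  by rewrite -!(dist_gt0 connG); case: inx => [? [? [? ?]]].
have [p xp dp] := inner_ex_farther F inx n1.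
have [p3 xp3 dp3] := inner_ex_farther F inx n3.
have [m xm dm] := dist_step connG n1; have [m3 xm3 dm3] := dist_step connG n3.
have Up w := side_farther_unique F ND inx side (w := w) (w' := p).
have Up3 w := side_farther_unique F' ND' inx' side' (w := w) (w' := p3).
have Um w := side_closer_unique F ND inx side (w := w) (w' := m).
have Um3 w := side_closer_unique F' ND' inx' side' (w := w) (w' := m3).
exists p, m, p3, m3; split.
- by [].
- by clear Up Up3 Um Um3; nbr b1 b2 b3 b4 xp; slia.
- by clear Up Up3 Um Um3; nbr b1 b2 b3 b4 xp3; slia.
move=> w xw.
have Ep : d x b1 < d w b1 -> w = p by move=> ?; apply: Up.
have Em : d w b1 < d x b1 -> w = m by move=> ?; apply: Um => //; rewrite dm.
have Ep3 : d x b3 < d w b3 -> w = p3 by move=> ?; apply: Up3.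
have Em3 : d w b3 < d x b3 -> w = m3 by move=> ?; apply: Um3 => //; rewrite dm3.
split=> //.
case: (ltngtP (d x b1) (d w b1)) => [/Ep|/Em|e1]; [by left | by right; left |].
case: (ltngtP (d x b3) (d w b3)) => [/Ep3|/Em3|e3].
- by right; right; left.
- by right; right; right.
clear Up Up3 Um Um3 Ep Ep3 Em Em3; suff xw' : x = w by move: xw; rewrite xw' edge_irrefl.
have R := inner_rect F inx.
case: (side_nbr F ND inx side xw) => [Rw|[[wb _]|[wb _]]].
- by move: R Rw; rewrite /rect => R Rw; apply: (cover_eq cov); slia.
- by move: R e1 inx; rewrite /rect /inner wb; dsym6 b1 b2 b3 b4; slia.
- by move: R e3 inx; rewrite /rect /inner wb; dsym6 b1 b2 b3 b4; slia.
Qed.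

(** If [p3], the neighbour farther from [b3], is on the rectangle, it goes along the side towards
    [b4] and so approaches [b1]: it equals [m]. Then the neighbours other than [m] are [p] and [m3],
    equal or adjacent, against [no_clique_neighbourhood]. Hence [p3] is [b4], at the end of a half
    leg. *)
Lemma side_half4 : edge x b4 /\ d b1 b4 + d b2 b4 = d b1 b2 + 1.
Proof.
have [p [m [p3 [m3 [[xp xm xp3 xm3] [dp dm] [dp3 dm3] N]]]]] := side_nbrs.
have R := inner_rect F inx.
have E3 := side_nbr F ND inx side xp3.
have [Rp3|[[pb H]|[<- H]]] : rect b1 b2 b3 b4 p3 \/ _ := E3; last by [].
- exfalso.
  have p3m : p3 = m.
    have [_ Em _ _ _] := N _ xp3; apply: Em.
    by move: R Rp3 side; rewrite /rect; nbr b1 b2 b3 b4 xp3; quad b1 b2 b3 b4 p3; slia.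
  rewrite p3m in dp3 Rp3.
  apply: (no_clique_neighbourhood F ND inx xm) => z z' xz xz' zm z'm zz'.
  have [_ _ _ _ Nz] := N _ xz; have [_ _ _ _ Nz'] := N _ xz'.
  have {}Nz : z = p \/ z = m3 
    by move: Nz zm; rewrite p3m => -[->|[->|[->|->]]]; rewrite ?eqxx //; [left | right].
  have {}Nz' : z' = p \/ z' = m3 
    by move: Nz' z'm; rewrite p3m => -[->|[->|[->|->]]]; rewrite ?eqxx //; [left | right].
  suff pm3 : p != m3 -> edge p m3.
    case: Nz Nz' => ez [] ez'.
    - by rewrite ez ez' eqxx in zz'.
    - by rewrite ez ez'; apply: pm3; rewrite -ez -ez'.
    - by rewrite ez ez' edge_sym; apply: pm3; rewrite -ez -ez' eq_sym.
    - by rewrite ez ez' eqxx in zz'.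
  move=> neq_pm3; apply: dist1_edge.
  have m3m : m3 != m by apply/eqP => e; rewrite e in dm3; slia.
  have m31 : d m3 b1 = d x b1.
    have [E1 E2 _ _ _] := N _ xm3; nbr b1 b2 b3 b4 xm3 => *.
    case: (ltngtP (d x b1) (d m3 b1)) => [/E1 e|/E2 e|->] //.
      by rewrite e eqxx in neq_pm3.
    by rewrite e eqxx in m3m.
  have [Rp|[[pb Hb]|[pb Hb]]] := side_nbr F ND inx side xp.
  + have [_ _ _ E _] := N _ xp; suff e : p = m3 by rewrite e eqxx in neq_pm3.
    by apply: E; move: R Rp side; rewrite /rect; nbr b1 b2 b3 b4 xp; quad b1 b2 b3 b4 p; slia.
  + have [Rm3|[[mb ?]|[mb ?]]] := side_nbr F ND inx side xm3.
    * by have := d1 xp; rewrite pb => xb; rewrite dC; move: R Rm3; rewrite /rect; slia.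
    * by rewrite pb mb eqxx in neq_pm3.
    * by move: dm3 R; rewrite mb /rect; dsym6 b1 b2 b3 b4; slia.
  + have := d1 xp; rewrite pb => xb; move: dp R side Hb; rewrite pb /rect.
    by dsym6 b1 b2 b3 b4; slia.
- have := d1 xp3; rewrite pb => xb; move: dp3 R side H; rewrite pb /rect.
  by dsym6 b1 b2 b3 b4; slia.
Qed.

End SideHalf.

Lemma side_square (b1 b2 b3 b4 x : G) : frame b1 b2 b3 b4 -> nondeg_frame b1 b2 b3 b4 ->
  inner b1 b2 b3 b4 x -> d x b2 + d x b4 = d b2 b4 ->
  [/\ d x b2 = 1 /\ d b2 b3 + d b2 b4 = d b3 b4 + 1,
      d x b4 = 1 /\ d b1 b4 + d b2 b4 = d b1 b2 + 1,
      exists2 z, edge x z & d z b1 = d x b1 /\ d z b3 + 1 = d x b3,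
      exists2 z, edge x z & d z b3 = d x b3 /\ d z b1 + 1 = d x b1 &
      forall w, edge x w -> d w b1 < d x b1 -> d w b3 < d x b3 -> False].
Proof.
move=> F ND inx side; have cov := F.1.
have [xb4 H4] := side_half4 F ND inx side.
have [xb2 H2] : edge x b2 /\ d b2 b3 + d b2 b4 = d b3 b4 + 1.
  have [||xb2 H2] := side_half4 (frame_swap F) (nondeg_swap ND) (x := x).
  - by move: inx; rewrite /inner; slia.
  - by rewrite addnC side dC.
  by split=> //; move: H2; dsym6 b1 b2 b3 b4; slia.
have [p [m [p3 [m3 [[xp xm xp3 xm3] [dp dm] [dp3 dm3] N]]]]] := side_nbrs F ND inx side.
have R := inner_rect F inx.
have f2 := d1 xb2; have f4 := d1 xb4.
(* If [m = m3], then every neighbour closer to [b3] is also closer to [b1]. The second neighbour [w]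
   of [b2] violates this: it is adjacent to [x], closer to [b3], and not closer to [b1]. *)
have mm3 : m <> m3.
  move=> e; rewrite -{}e in dm3 N.
  have xb2' : edge b2 x by rewrite edge_sym.
  have [w bw wx] := leafless xb2'.
  have f2w : d w b2 = 1 by rewrite dC d1.
  have no : d x w = 1 -> d w b3 < d x b3 -> d x b1 <= d w b1 -> False.
    by move=> /dist1_edge/N[_ _ _ E _] /E->; slia.
  have [inw|E] := inner_or b1 b2 b3 b4 w.
    have Rw := inner_rect F inw.
    have xw0 : 0 < d x w by rewrite (dist_gt0 connG) eq_sym.
    have {}wx : w <> x by apply/eqP.
    have := cover_extension x w cov.
    quad b1 b2 b3 b4 w; move: Rw R; rewrite /rect => *.
    have [e4|e4] : d w b4 = 1 \/ d w b4 = 2 by slia.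
      by apply: wx; apply: (cover_eq cov); slia.
    by apply: no; slia.
  case: E => [|[|[|]]] e; rewrite e in no bw f2w.
  - by move: inx R; rewrite /rect /inner; slia.
  - by rewrite d0 in f2w.
  - apply: no; move: R; rewrite /rect; dsym6 b1 b2 b3 b4; quad b1 b2 b3 b4 x; try slia.
    by have := dist_tri3 b1 b2 b3; slia.
  - by move: R; rewrite /rect; dsym6 b1 b2 b3 b4; slia.
have eb2 : b2 = p.
  by have [E _ _ _ _] := N _ xb2; apply: E; move: R; rewrite /rect; dsym6 b1 b2 b3 b4; slia.
have eb4 : b4 = p3.
  by have [_ _ E _ _] := N _ xb4; apply: E; move: R; rewrite /rect; dsym6 b1 b2 b3 b4; slia.
split=> //.
- exists m3 => //; split; last by [].
  have [E1 E2 _ _ _] := N _ xm3.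
  case: (ltngtP (d x b1) (d m3 b1)) => [/E1 e|/E2 e|->] //; last by case: mm3.
  by move: dm3 R; rewrite e -eb2 /rect; dsym6 b1 b2 b3 b4; slia.
- exists m => //; split; last by [].
  have [_ _ E1 E2 _] := N _ xm.
  case: (ltngtP (d x b3) (d m b3)) => [/E1 e|/E2 e|->] //.
  by move: dm R; rewrite e -eb4 /rect; dsym6 b1 b2 b3 b4; slia.
- by move=> w xw l1 l3; have [_ E1 _ E3 _] := N _ xw; apply: mm3; rewrite -(E1 l1) -(E3 l3).
Qed.

Lemma side_config (b1 b2 b3 b4 x : G) : frame b1 b2 b3 b4 -> nondeg_frame b1 b2 b3 b4 ->
  inner b1 b2 b3 b4 x -> d x b2 + d x b4 = d b2 b4 ->
  (d x b1 = 1 /\ d x b2 = 1 /\ d x b3 = 1 /\ d x b4 = 1) /\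
  (d b1 b2 = 2 /\ d b3 b4 = 2 /\ d b2 b4 = 2) /\
  (d b1 b3 = 1 /\ d b1 b4 = 1 /\ d b2 b3 = 1).
Proof.
move=> F ND inx side; have cov := F.1; have R := inner_rect F inx.
have [[f2 H2] [f4 H4] [z xz [z1 z3]] [z' xz' [z'3 z'1]] _] := side_square F ND inx side.
have Rz : d z b2 = 1 /\ d z b4 = 2.
  case: (side_nbr F ND inx side xz) => [|[[e _]|[e _]]]; rewrite ?e in z1 z3.
  - by move: R; rewrite /rect; slia.
  - by move: R; rewrite /rect; dsym6 b1 b2 b3 b4; slia.
  - by move: R; rewrite /rect; dsym6 b1 b2 b3 b4; slia.
have Rz' : d z' b2 = 2 /\ d z' b4 = 1.
  case: (side_nbr F ND inx side xz') => [|[[e _]|[e _]]]; rewrite ?e in z'1 z'3.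
  - by move: R; rewrite /rect; slia.
  - by move: R; rewrite /rect; dsym6 b1 b2 b3 b4; slia.
  - by move: R; rewrite /rect; dsym6 b1 b2 b3 b4; slia.
have zz' : edge z z'.
  by apply: dist1_edge; have := cover_extension z z' cov; slia.
(* An inner [z] would lie on the side from [b2] to [b3]. There [z'] is a neighbour closer to both
   [b1] and [b4], which [side_square] excludes for that side. *)
have ez : z = b3.
  have [inz|] := inner_or b1 b2 b3 b4 z.
    have [||_ _ _ _ E] := side_square (frame_swap34 F) (nondeg_swap34 ND) (x := z).
    - by move: inz; rewrite /inner; slia.
    - by move: R; rewrite /rect; slia.
    by exfalso; apply: (E _ zz'); slia.
  case=> [e|[e|[//|e]]]; exfalso; rewrite e ?d0 in z1 Rz.
  - by move: inx; rewrite /inner; slia.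
  - by slia.
  - by slia.
have ez' : z' = b1.
  have [inz|] := inner_or b1 b2 b3 b4 z'.
    have [||_ _ _ _ E] := side_square (frame_swap12 F) (nondeg_swap12 ND) (x := z').
    - by move: inz; rewrite /inner; slia.
    - by move: R; rewrite /rect; slia.
    by exfalso; apply: (E z); rewrite 1?edge_sym //; slia.
  case=> [//|[e|[e|e]]]; exfalso; rewrite e ?d0 in z'3 Rz'.
  - by slia.
  - by move: inx; rewrite /inner; slia.
  - by slia.
move: z1 z3 z'1 z'3 Rz Rz' R; rewrite ez ez' /rect; dsym6 b1 b2 b3 b4; slia.
Qed.

Lemma dist_between x y n : n <= d x y -> exists2 z, d x z = n & d z y = d x y - n.
Proof.
elim: n => [_|n IHn ny]; first by exists x; rewrite ?d0 ?subn0.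
have [|z xz zy] := IHn; first by slia.
have [|w zw dzy] := dist_step connG (x := z) (y := y).
  by rewrite -(dist_gt0 connG) zy; slia.
exists w; last by slia.
have := d1 zw; have := dist_tri3 x w z; have := dist_tri3 x y w.
by have := dC z x; have := dC w x; slia.
Qed.

Lemma side_iso (b1 b2 b3 b4 x : G) : frame b1 b2 b3 b4 -> nondeg_frame b1 b2 b3 b4 ->
  inner b1 b2 b3 b4 x -> d x b2 + d x b4 = d b2 b4 -> isomorphic G H4.
Proof.
move=> F ND inx side; have cov := F.1.
have [X [E1 E2]] := side_config F ND inx side.
have all_x y : y = x \/ y = b4 \/ y = b2 \/ y = b3 \/ y = b1.
  have [iny|] := inner_or b1 b2 b3 b4 y; last by tauto.
  (* Both diagonals have length 2, so every coordinate of an inner vertex is 1. *)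
  left; have := inner_rect F iny; move: iny; rewrite /rect /inner => *.
  by apply: (cover_eq cov); slia.
by apply: (iso_H4 connG all_x); dsym6 b1 b2 b3 b4; slia.
Qed.

(** * Nondegenerate rectangles with no inner vertex on a side *)

Lemma no_side_iso (b1 b2 b3 b4 x0 : G) :
  frame b1 b2 b3 b4 -> nondeg_frame b1 b2 b3 b4 -> inner b1 b2 b3 b4 x0 ->
  (forall x, inner b1 b2 b3 b4 x ->
    (d x b1 + d x b3 <> d b1 b3 /\ d x b2 + d x b4 <> d b2 b4) /\
    (d x b1 + d x b4 <> d b1 b4 /\ d x b2 + d x b3 <> d b2 b3)) ->
  d b1 b3 = 1 -> d b2 b4 = 1 -> d b1 b4 = d b2 b3 ->
  d b1 b2 = d b1 b4 + 1 -> d b3 b4 = d b1 b4 + 1 -> isomorphic G H1.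
Proof.
move=> F ND in0 nos e13 e24 e14 e12 e34; have cov := F.1.
(* Off the sides b1b4 and b2b3 the two distance sums are at least the length of a diagonal. This
   puts [y] on the midline, equally far from both ends of each short side. *)
have line y : inner b1 b2 b3 b4 y -> d y b3 = d y b1 /\ d y b2 = d y b4 /\ d y b1 + d y b2 =
  d b1 b2.
  move=> iny; have := inner_rect F iny; have := nos y iny; rewrite /rect.
  by quad b1 b2 b3 b4 y; slia.
have [L1|L2] : d b1 b4 = 1 \/ 2 <= d b1 b4.
  by have := nos x0 in0; have := line x0 in0; have := inner_rect F in0; move: in0 ND;
     rewrite /rect /inner /nondeg_frame; slia.
- have all_x y : y = x0 \/ y = b1 \/ y = b3 \/ y = b2 \/ y = b4.
    have [iny|] := inner_or b1 b2 b3 b4 y; last by tauto.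
    left; have := inner_rect F iny; have := inner_rect F in0; move: in0 iny;
      rewrite /rect /inner => *.
    by apply: (cover_eq cov); slia.
  have := inner_rect F in0; move: in0; rewrite /rect /inner => *.
  by apply: (iso_H1 connG all_x); dsym6 b1 b2 b3 b4; slia.
(* A longer rectangle is impossible: the second neighbour [x1] of [b1] has at most [b1], [b3] and
   one further vertex [y] as neighbours, and the edge b1b3 makes all but [y] a clique. *)
exfalso.
have e : edge b1 b3 by apply: dist1_edge.
have [x1 bx1 x1b3] := leafless e.
have f1 : d x1 b1 = 1 by rewrite dC d1.
have in1 : inner b1 b2 b3 b4 x1.
  have [//|] := inner_or b1 b2 b3 b4 x1; move=> E; exfalso.
  case: E => [|[|[|]]] e1; rewrite e1 ?d0 ?eqxx // in f1 x1b3.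
    by move: f1; dsym6 b1 b2 b3 b4; slia.
  by move: f1; dsym6 b1 b2 b3 b4; slia.
have [l3 [l4 l12]] := line _ in1.
have x1n : x1 != b1 by rewrite -(dist_gt0 connG) f1.
have [y xy far_y] := inner_ex_farther F in1 x1n.
have f1y : d y b1 = 2 by have := dist_edge_both b1 xy; slia.
have nbr w : edge x1 w -> w = b1 \/ w = b3 \/ w = y.
  move=> xw; have [inw|E] := inner_or b1 b2 b3 b4 w.
    right; right.
    have iny : inner b1 b2 b3 b4 y.
      have [//|] := inner_or b1 b2 b3 b4 y; move=> E; exfalso; have := d1 xy.
      by case: E f1y => [|[|[|]]] ->; dsym6 b1 b2 b3 b4; slia.
    have [ly3 [ly4 ly12]] := line _ iny; have [lw3 [lw4 lw12]] := line _ inw.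
    suff e1 : d w b1 = 2 by apply: (cover_eq cov); slia.
    have xw' : 0 < d x1 w by rewrite (d1 xw).
    have := cover_extension x1 w cov; have := dist_edge_both b1 xw.
    have := cover_extension w x1 cov; rewrite (dC w x1).
    by move: inw; rewrite /inner; slia.
  have := d1 xw; case: E => [|[|[|]]] ->; [by left | | by right; left | ].
    by move=> ?; exfalso; slia.
  by move=> ?; exfalso; slia.
apply: (no_clique_neighbourhood F ND in1 xy) => z z' /nbr Nz /nbr Nz' zy z'y zz'.
case: Nz => [ez|[ez|ez]]; last by rewrite ez eqxx in zy.
  case: Nz' => [ez'|[ez'|ez']]; last by rewrite ez' eqxx in z'y.
    by rewrite ez ez' eqxx in zz'.
  by rewrite ez ez'.
case: Nz' => [ez'|[ez'|ez']]; last by rewrite ez' eqxx in z'y.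
  by rewrite ez ez' edge_sym.
by rewrite ez ez' eqxx in zz'.
Qed.

(** An inner neighbour of [b1] has forced coordinates, so there is at most one; the second neighbour
    granted by leaflessness is [b3] or [b4], whence a side of length 1. A half leg at [b1] would
    rule out inner neighbours, so that b1, b3, b4 form a triangle, and the diagonal b3b4 of length 1
    leaves no room for [x0]. *)
Lemma nondeg_no_side (b1 b2 b3 b4 x0 : G) :
  frame b1 b2 b3 b4 -> nondeg_frame b1 b2 b3 b4 -> inner b1 b2 b3 b4 x0 ->
  (forall x, inner b1 b2 b3 b4 x ->
    (d x b1 + d x b3 <> d b1 b3 /\ d x b2 + d x b4 <> d b2 b4) /\
    (d x b1 + d x b4 <> d b1 b4 /\ d x b2 + d x b3 <> d b2 b3)) ->
  (d b1 b3 + d b1 b4 = d b3 b4) /\ (d b1 b3 = 1 \/ d b1 b4 = 1).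
Proof.
move=> F ND in0 nos; have cov := F.1; have H := half_legs F.
have R0 := inner_rect F in0.
have [u /(dist_step connG)[w bw _]] := exists_neq b1 G_gt1.
have [w' bw' ww'] := leafless bw.
have nbr z : edge b1 z -> z = b3 \/ z = b4 \/
  (d b1 b3 + d b1 b4 = d b3 b4 /\ d z b1 = 1 /\ d z b2 + 1 = d b1 b2 /\ d z b3 = d b1 b3 /\ d
    z b4 = d b1 b4).
  move=> bz; have := d1 bz; rewrite dC => f1z.
  have [inz|E] := inner_or b1 b2 b3 b4 z.
    right; right; have Rz := inner_rect F inz; have := nos z inz.
    by move: Rz inz; rewrite /rect /inner; quad b1 b2 b3 b4 z; slia.
  case: E => [e|[e|[->|->]]]; [| |by left|by right; left]; exfalso; rewrite e in f1z.
    by rewrite d0 in f1z.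
  by move: R0 in0; rewrite /rect /inner; dsym6 b1 b2 b3 b4; slia.
have full : d b1 b3 + d b1 b4 = d b3 b4.
  have [//|full] := eqVneq (d b1 b3 + d b1 b4) (d b3 b4).
  have {}nbr z : edge b1 z -> z = b3 \/ z = b4.
    by move=> /nbr[|[|[/eqP]]]; [left|right|rewrite (negPf full)].
  have : d b1 b3 = 1 /\ d b1 b4 = 1.
    have := d1 bw; have := d1 bw'.
    by move: ww'; case: (nbr _ bw) (nbr _ bw') => -> [] ->; rewrite ?eqxx.
  by move: R0 in0 H; rewrite /rect /inner; move/eqP: full; slia.
split=> //.
case: (nbr _ bw) => [e|[e|[_ V]]]; [by left; rewrite -e d1 | by right; rewrite -e d1 |].
case: (nbr _ bw') => [e|[e|[_ V']]]; [by left; rewrite -e d1 | by right; rewrite -e d1 |].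
by case/eqP: ww'; apply: (cover_eq cov); slia.
Qed.

(** A vertex on some side reduces to [side_iso] by the symmetries of the rectangle. Otherwise the
    equations at the four corners say that all legs vanish and opposite sides are equal, one pair
    having length 1. *)
Lemma nondeg_iso (b1 b2 b3 b4 x0 : G) :
  frame b1 b2 b3 b4 -> nondeg_frame b1 b2 b3 b4 -> inner b1 b2 b3 b4 x0 ->
  isomorphic G H1 \/ isomorphic G H4.
Proof.
move=> F ND in0.
have F12 := frame_swap12 F; have F34 := frame_swap34 F.
have F1234 := frame_swap12 F34; have Fs := frame_swap F.
have Fs12 := frame_swap12 Fs.
have ND12 := nondeg_swap12 ND; have ND34 := nondeg_swap34 ND.
have ND1234 := nondeg_swap12 ND34; have NDs := nondeg_swap ND.
have NDs12 := nondeg_swap12 NDs.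
pose onside x := [|| d x b2 + d x b4 == d b2 b4, d x b1 + d x b3 == d b1 b3,
  d x b1 + d x b4 == d b1 b4 | d x b2 + d x b3 == d b2 b3].
pose innerb x := [&& 0 < d x b1, 0 < d x b2, 0 < d x b3 & 0 < d x b4].
have innerP x : inner b1 b2 b3 b4 x <-> innerb x.
  by rewrite /inner /innerb; split; lia.
case: (boolP [exists x, innerb x && onside x]) => [/existsP[x /andP[/innerP inx on]]|].
  right; case/or4P: on => /eqP side.
  - exact: (side_iso F ND inx side).
  - apply: (@side_iso b2 b1 b4 b3 x) => //.
      by move: inx; rewrite /inner; slia.
  - apply: (@side_iso b2 b1 b3 b4 x) => //.
    by move: inx; rewrite /inner; slia.
  - apply: (@side_iso b1 b2 b4 b3 x) => //.
    by move: inx; rewrite /inner; slia.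
rewrite negb_exists => /forallP no; left.
have nos x : inner b1 b2 b3 b4 x ->
    (d x b1 + d x b3 <> d b1 b3 /\ d x b2 + d x b4 <> d b2 b4) /\
    (d x b1 + d x b4 <> d b1 b4 /\ d x b2 + d x b3 <> d b2 b3).
  by move/innerP => inx; have := no x; rewrite inx /= /onside; slia.
have [f1 e1] := nondeg_no_side F ND in0 nos.
have [||f2 _] := nondeg_no_side F12 ND12 (x0 := x0).
- by move: in0; rewrite /inner; slia.
- move=> x inx; have := nos x; move: inx; rewrite /inner; dsym6 b1 b2 b3 b4; clear; lia.
have [||f3 _] := nondeg_no_side Fs NDs (x0 := x0).
- by move: in0; rewrite /inner; slia.
- move=> x inx; have := nos x; move: inx; rewrite /inner; dsym6 b1 b2 b3 b4; clear; lia.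
have [||f4 _] := nondeg_no_side Fs12 NDs12 (x0 := x0).
- by move: in0; rewrite /inner; slia.
- move=> x inx; have := nos x; move: inx; rewrite /inner; dsym6 b1 b2 b3 b4; clear; lia.
have : d b1 b3 = d b2 b4 /\ d b1 b4 = d b2 b3 /\ d b1 b2 = d b1 b3 + d b1 b4.
  by move: f1 f2 f3 f4; dsym6 b1 b2 b3 b4; slia.
case=> e13 [e14 e12]; case: e1 => e1.
  by apply: (no_side_iso F ND in0 nos); slia.
apply: (no_side_iso F34 ND34 (x0 := x0)); rewrite ?(dC b4 b3); try slia.
  by move: in0; rewrite /inner; slia.
by move=> x inx; have := nos x; move: inx; rewrite /inner; clear; lia.
Qed.

Lemma two_neighbours (a b c e : G) : (forall x, x = a \/ x = b \/ x = c \/ x = e) ->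
  (d a b = 1 /\ d a c = 1) \/ (d a b = 1 /\ d a e = 1) \/ (d a c = 1 /\ d a e = 1).
Proof.
move=> cov; have [u /(dist_step connG)[w bw _]] := exists_neq a G_gt1.
have [w' bw' ww'] := leafless bw; have := d1 bw; have := d1 bw'.
have nbr z : edge a z -> z = b \/ z = c \/ z = e.
  move=> az; case: (cov z) => [e1|//]; by rewrite e1 edge_irrefl in az.
move: ww'; case: (nbr _ bw) => [->|[->|->]]; case: (nbr _ bw') => [->|[->|->]];
  rewrite ?eqxx // => _ *; tauto.
Qed.

(** Each vertex has two of the three others as neighbours, so at most two disjoint pairs are
    nonadjacent; strictness of the frame makes such pairs diagonals and rules out K4. *)
Lemma nondeg_empty (b1 b2 b3 b4 : G) : nondeg_frame b1 b2 b3 b4 ->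
  (forall x, x = b1 \/ x = b2 \/ x = b3 \/ x = b4) ->
  isomorphic G H2 \/ isomorphic G H5.
Proof.
move=> ND cov.
have T1 := two_neighbours cov.
have T2 : _ := @two_neighbours b2 b1 b3 b4 (fun x => ltac:(have := cov x; tauto)).
have T3 : _ := @two_neighbours b3 b1 b2 b4 (fun x => ltac:(have := cov x; tauto)).
have T4 : _ := @two_neighbours b4 b1 b2 b3 (fun x => ltac:(have := cov x; tauto)).
have [E|[E|E]] :
  (d b1 b2 = 2 /\ d b3 b4 = 2 /\ d b1 b3 = 1 /\ d b1 b4 = 1 /\ d b2 b3 = 1 /\ d b2 b4 = 1) \/
  (d b1 b2 = 2 /\ d b3 b4 = 1 /\ d b1 b3 = 1 /\ d b1 b4 = 1 /\ d b2 b3 = 1 /\ d b2 b4 = 1) \/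
  (d b1 b2 = 1 /\ d b3 b4 = 2 /\ d b1 b3 = 1 /\ d b1 b4 = 1 /\ d b2 b3 = 1 /\ d b2 b4 = 1).
  move: ND T1 T2 T3 T4; rewrite /nondeg_frame.
  rewrite (dC b2 b1) (dC b3 b1) (dC b3 b2) (dC b4 b1) (dC b4 b2) (dC b4 b3).
  have := dist_tri3 b1 b2 b3; have := dist_tri3 b3 b4 b1.
  rewrite (dC b3 b1) (dC b3 b2) => t1 t2 N T1 T2 T3 T4.
  case: T1 => [|[]] T1; case: T2 => [|[]] T2; clear cov; by slia.
- left; apply: (@iso_H2 G connG b1 b3 b2 b4);
    [by move=> y; have := cov y; tauto | by dsym6 b1 b2 b3 b4; slia ..].
- right; apply: (@iso_H5 G connG b1 b2 b3 b4);
    [by move=> y; have := cov y; tauto | by dsym6 b1 b2 b3 b4; slia ..].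
- right; apply: (@iso_H5 G connG b3 b4 b1 b2);
    [by move=> y; have := cov y; tauto | by dsym6 b1 b2 b3 b4; slia ..].
Qed.

(** * Degenerate rectangles *)

Lemma degenerate_end (b1 b2 b3 b4 : G) : frame b1 b2 b3 b4 ->
  d b1 b2 + d b3 b4 = d b1 b3 + d b2 b4 -> d b1 b4 = 0 ->
  isomorphic G (complete_graph 3).
Proof.
move=> F deg e14; have cov := F.1; have H := half_legs F.
have b14 : b4 = b1 by apply/esym/dist0_eq.
have [eD e23] : (d b1 b3 = d b1 b2 /\ d b2 b4 = d b1 b2 /\ d b3 b4 = d b1 b2) /\ d b2 b3 <= 1.
  by have := dist_tri3 b1 b2 b4; have := dist_tri3 b1 b3 b4;
    move: H; dsym6 b1 b2 b3 b4; slia.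
have [u /(dist_step connG)[w bw _]] := exists_neq b1 G_gt1.
have [w' bw' ww'] := leafless bw.
(* Unless the graph is the triangle, all neighbours of [b1] have the same coordinates, so [b1] would
   have only one neighbour. *)
have nbr z : ~ (d b1 b2 = 1 /\ d b2 b3 = 1) -> edge b1 z ->
  [/\ d z b1 = 1, d z b2 = d b1 b2 - 1, d z b3 = d b1 b2 - 1 & d z b4 = 1].
  move=> nK /d1; rewrite dC => f1.
  have [inz|E] := inner_or b1 b2 b3 b4 z.
    have Rz := inner_rect F inz; rewrite b14; move: Rz inz; rewrite /rect /inner b14 => Rz inz.
    by move: eD; rewrite b14; quad b1 b2 b3 b4 z; split; slia.
  case: E => [e|[e|[e|e]]]; rewrite e ?b14 ?d0 in f1 *; move: f1 eD => f1 eD //.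
  - by move: eD; rewrite b14; dsym6 b1 b2 b3 b4; split; slia.
  - by move: eD; rewrite b14; dsym6 b1 b2 b3 b4; split; slia.
have [K|nK] : (d b1 b2 = 1 /\ d b2 b3 = 1) \/ ~ (d b1 b2 = 1 /\ d b2 b3 = 1) by lia.
  apply: (@iso_K3 G connG b1 b2 b3); [| slia ..].
  move=> y; have [iny|] := inner_or b1 b2 b3 b4 y; last by rewrite b14; tauto.
  by exfalso; have := inner_rect F iny; move: iny; rewrite /rect /inner; slia.
have [V1 V2 V3 V4] := nbr _ nK bw; have [V1' V2' V3' V4'] := nbr _ nK bw'.
by case/eqP: ww'; apply: (cover_eq cov); slia.
Qed.

(** The rectangle is a segment with two half legs at each end, so the listed points form the edges
    b1b4 and b2b3. An inner vertex is determined by its distance to [b1]. Length 1 leaves no inner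
    vertex and gives K4; length k+2 leaves a path of k+1 vertices. *)
Lemma degenerate_line (b1 b2 b3 b4 : G) : frame b1 b2 b3 b4 ->
  d b1 b2 + d b3 b4 = d b1 b3 + d b2 b4 -> d b1 b4 = 1 -> d b2 b3 = 1 ->
  isomorphic G H3 \/ exists k, isomorphic G (H6 k).
Proof.
move=> F deg e14 e23; have cov := F.1; have H := half_legs F.
have [e13 [e24 e34]] : d b1 b3 = d b1 b2 /\ d b2 b4 = d b1 b2 /\ d b3 b4 = d b1 b2.
  by move: H; slia.
have line x : inner b1 b2 b3 b4 x ->
  [/\ d x b3 = d x b2, d x b4 = d x b1 & d x b1 + d x b2 = d b1 b2].
  by move=> inx; have := inner_rect F inx; rewrite /rect; quad b1 b2 b3 b4 x; split; slia.
have [eD|[D1|[k Dk]]] : d b1 b2 = 0 \/ d b1 b2 = 1 \/ exists k, d b1 b2 = k.+2.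
  case: (d b1 b2) => [|[|k]]; [by left | by right; left | by right; right; exists k].
- by exfalso; have := dist_tri3 b1 b4 b2; have := dC b2 b1; slia.
- left; apply: (@iso_H3 G connG b1 b2 b3 b4); [| slia ..].
  move=> y; have [iny|//] := inner_or b1 b2 b3 b4 y.
  by exfalso; have [_ _] := line _ iny; move: iny; rewrite /inner; slia.
right; exists k.
(* The path starts next to [b1], hence [t.+1]; the two distances add up to [k.+2]. *)
have ex (t : 'I_k.+1) : exists x, (d x b1 == t.+1) && (d x b2 == k.+1 - t).
  have := ltn_ord t => tk; have [|z z1 z2] := @dist_between b1 b2 t.+1; first by rewrite Dk;
    lia.
  by exists z; rewrite dC z1 z2 Dk; lia.
pose lev t := xchoose (ex t).
have levP t : d (lev t) b1 = t.+1 /\ d (lev t) b2 = k.+1 - t.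
  by have /andP[/eqP ? /eqP ?] := xchooseP (ex t).
have lev_in t : inner b1 b2 b3 b4 (lev t).
  have [L1 L2] := levP t; have := ltn_ord t => tk.
  have [//|E] := inner_or b1 b2 b3 b4 (lev t); exfalso; move: L1 L2.
  by case: E => [|[|[|]]] ->; dsym6 b1 b2 b3 b4; slia.
pose f (x : H6 k) : G := match x with inl i => pick4 b1 b4 b2 b3 i | inr t => lev t end.
apply: (@isomorphic_dist G (H6 k) (fork_dist true (k := k)) f connG).
- by move=> a b; apply: fork_dist_eq0.
- by move=> a b; apply: fork_dist_eq1.
- move=> x; have [inx|E] := inner_or b1 b2 b3 b4 x.
    have [l3 l4 l12] := line _ inx.
    have tk : (d x b1).-1 < k.+1 by move: inx; rewrite /inner; slia.
    exists (inr (Ordinal tk)) => /=.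
    have [L1 L2] := levP (Ordinal tk); have [m3 m4 m12] := line _ (lev_in (Ordinal tk)).
    by move: inx L1 L2; rewrite /inner /= => *; apply: (cover_eq cov); slia.
  have [i <-] : exists i : 'I_4, pick4 b1 b4 b2 b3 i = x by apply: pick4_surj; tauto.
  by exists (inl i).
have fl i t : d (lev t) (pick4 b1 b4 b2 b3 i) = if i < 2 then t.+1 else k.+1 - t.
  have [L1 L2] := levP t; have [l3 l4 l12] := line _ (lev_in t).
  by case: i => [|[|[|i]]] //=; slia.
case=> [i|s] [j|t].
- by rewrite /fork_dist eq_inl; ord4_cases i; ord4_cases j => /=; rewrite ?eqxx /=;
    dsym6 b1 b2 b3 b4; slia.
- rewrite dC /= fl /fork_dist /=; have := ltn_ord t.
  by ord4_cases i => /=; iflia.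
- rewrite /= fl /fork_dist /=; have := ltn_ord s.
  by ord4_cases j => /=; iflia.
rewrite /fork_dist eq_inr /=; case: eqP => [/ord_inj->|st]; first by rewrite d0.
have [L1 L2] := levP s; have [l3 l4 l12] := line _ (lev_in s).
have [M1 M2] := levP t; have [m3 m4 m12] := line _ (lev_in t).
have := cover_extension (lev s) (lev t) cov.
have := dist_tri3 (lev s) (lev t) b1; have := dC b1 (lev s); have := dC b1 (lev t).
by have := ltn_ord s; have := ltn_ord t; case: ifP => [|_]; slia.
Qed.

Lemma frame_exists : #|boundary G| <= 4 -> exists b1 b2 b3 b4 : G, frame b1 b2 b3 b4.
Proof.
move=> le4; have /card_gt0P[a _] := connG.1.
(* The default [a] pads the list when the boundary has fewer than four vertices. *)
pose b i := nth a (enum (boundary G)) i.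
have cov v : v \in boundary G -> v = b 0 \/ v = b 1 \/ v = b 2 \/ v = b 3.
  rewrite -mem_enum => /(nthP a)[i]; rewrite -cardE => ib <-.
  have : i < 4 by apply: leq_trans le4.
  by case: i {ib} => [|[|[|[|]]]] // _; tauto.
have [S1|[S1|S1]] : 
  (d (b 0) (b 2) + d (b 1) (b 3) <= d (b 0) (b 1) + d (b 2) (b 3) /\
   d (b 0) (b 3) + d (b 1) (b 2) <= d (b 0) (b 1) + d (b 2) (b 3)) \/
  (d (b 0) (b 1) + d (b 2) (b 3) <= d (b 0) (b 2) + d (b 1) (b 3) /\
   d (b 0) (b 3) + d (b 1) (b 2) <= d (b 0) (b 2) + d (b 1) (b 3)) \/
  (d (b 0) (b 2) + d (b 1) (b 3) <= d (b 0) (b 3) + d (b 1) (b 2) /\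
   d (b 0) (b 1) + d (b 2) (b 3) <= d (b 0) (b 3) + d (b 1) (b 2)) by lia.
- by exists (b 0), (b 1), (b 2), (b 3).
- exists (b 0), (b 2), (b 1), (b 3); split; first by move=> v /cov; tauto.
  by rewrite (dC (b 2) (b 1)).
- exists (b 0), (b 3), (b 1), (b 2); split; first by move=> v /cov; tauto.
  by rewrite (dC (b 3) (b 2)) (dC (b 3) (b 1)); lia.
Qed.

Theorem leafless_classification : #|boundary G| <= 4 ->
  isomorphic G (complete_graph 3) \/ isomorphic G H1 \/ isomorphic G H2 \/
  isomorphic G H3 \/ isomorphic G H4 \/ isomorphic G H5 \/ exists k, isomorphic G (H6 k).
Proof.
case/frame_exists => b1 [b2 [b3 [b4 F]]].
have deg_case (c1 c2 c3 c4 : G) : frame c1 c2 c3 c4 ->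
  d c1 c2 + d c3 c4 = d c1 c3 + d c2 c4 ->
  isomorphic G (complete_graph 3) \/ isomorphic G H3 \/ exists k, isomorphic G (H6 k).
  move=> Fc deg; have H := half_legs Fc.
  (* Across a rectangle of width zero, [c1] and [c4] are separated only by their two half legs. *)
  have [e14|e14] : d c1 c4 = 0 \/ d c1 c4 = 1 by slia.
    by left; apply: (degenerate_end Fc).
  have [e23|e23] : d c2 c3 = 0 \/ d c2 c3 = 1 by slia.
    left; apply: (degenerate_end (frame_swap34 (frame_swap12 Fc))) => //.
    by rewrite (dC c2 c1) (dC c4 c3) deg addnC.
  by right; apply: (degenerate_line Fc).
have [ND|[D13|D14]] : nondeg_frame b1 b2 b3 b4 \/
  d b1 b2 + d b3 b4 = d b1 b3 + d b2 b4 \/ d b1 b2 + d b4 b3 = d b1 b4 + d b2 b3.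
  by have [_] := F; rewrite (dC b4 b3) /nondeg_frame; slia.
- have [|/existsPn no] := boolP [exists x, x \notin [:: b1; b2; b3; b4]].
    case/existsP => x; rewrite !inE !negb_or -!(dist_gt0 connG) => /and4P in0.
    have : isomorphic G H1 \/ isomorphic G H4; last by tauto.
    by apply: (nondeg_iso F ND (x0 := x)); case: in0.
  have : isomorphic G H2 \/ isomorphic G H5; last by tauto.
  apply: (nondeg_empty ND).
  by move=> x; have := no x; rewrite negbK !inE => /or4P[] /eqP->; tauto.
- by have [?|[?|?]] := deg_case _ _ _ _ F D13; tauto.
- by have [?|[?|?]] := deg_case _ _ _ _ (frame_swap34 F) D14; tauto.
Qed.

End Leafless.

(** * Isomorphisms and boundary criteria *)

Lemma isomorphic_sym (G H : sgraph) : isomorphic G H -> isomorphic H G.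
Proof.
case=> f [g fK gK] f_mono; exists g; first by exists f.
by move=> x y; rewrite -f_mono !gK.
Qed.

Lemma isomorphic_trans (G H K : sgraph) :
  isomorphic G H -> isomorphic H K -> isomorphic G K.
Proof.
case=> f fb fm [g gb gm]; exists (g \o f); first exact: bij_comp.
by move=> x y /=; rewrite gm fm.
Qed.

Lemma has_walk_iso (G H : sgraph) (f : G -> H) (x y : G) n :
  {mono f : x y / edge x y} -> has_walk x y n -> has_walk (f x) (f y) n.
Proof.
move=> f_mono /has_walkP[p [pp <- <-]]; apply/has_walkP; exists (map f p).
rewrite last_map size_map path_map; split=> //.
by rewrite (eq_path (e' := edge)) // => a b /=; rewrite f_mono.
Qed.

Lemma iso_card (G H : sgraph) : isomorphic G H -> #|{: G}| = #|{: H}|.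
Proof. by case=> f /bij_eq_card ->. Qed.

Lemma iso_connected (G H : sgraph) : isomorphic G H -> connected G -> connected H.
Proof.
move=> GH [G0 connG]; split; first by rewrite -(iso_card GH).
case: GH => f [g fK gK] fm x y; rewrite -(gK x) -(gK y).
have /has_walkP[p [pp lp _]] := has_walk_iso fm (dist_has_walk (connG (g x) (g y))).
by apply/connectP; exists p.
Qed.

Lemma iso_dist (G H : sgraph) (f : G -> H) : connected G ->
  bijective f -> {mono f : x y / edge x y} -> forall x y, dist (f x) (f y) = dist x y.
Proof.
move=> connG fb fm x y; have connH : connected H.
  by apply: iso_connected connG; exists f.
have [g fK gK] := fb.
have gm : {mono g : x y / edge x y} by move=> a b; rewrite -fm !gK.
apply/eqP; rewrite eqn_leq; apply/andP; split; apply: dist_le.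
  by apply: (has_walk_iso fm); apply: dist_has_walk; case: connG.
rewrite -{1}(fK x) -{1}(fK y); apply: (has_walk_iso gm).
by apply: dist_has_walk; case: connH.
Qed.

Lemma iso_closer (G H : sgraph) (f : G -> H) : connected G ->
  bijective f -> {mono f : x y / edge x y} ->
  forall x u, closer (f x) (f u) = closer x u /\ farther (f x) (f u) = farther x u.
Proof.
move=> connG fb fm x u; have fd := iso_dist connG fb fm; have [g fK gK] := fb.
have card_eq (P : G -> bool) (Q : H -> bool) : (forall w, Q (f w) = P w) ->
    #|[set w in nbhd (f x) | Q w]| = #|[set w in nbhd x | P w]|.
  move=> PQ; rewrite -[RHS](card_imset _ (can_inj fK)); apply: eq_card => w.
  rewrite !inE; apply/idP/imsetP => [/andP[aw lw]|[z]].
    by exists (g w); rewrite ?gK // !inE -fm gK aw -PQ gK.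
  by rewrite !inE => /andP[az lz] ->; rewrite fm az PQ.
by split; apply: card_eq => w; rewrite !fd.
Qed.

Lemma iso_boundary (G H : sgraph) (f : G -> H) : connected G ->
  bijective f -> {mono f : x y / edge x y} ->
  forall x, (f x \in boundary H) = (x \in boundary G).
Proof.
move=> connG fb fm x; have GH : isomorphic G H by exists f.
have connH := iso_connected GH connG; have eqc := iso_card GH.
have [G1|G_gt1] := leqP #|{: G}| 1.
  have c1 : #|{: G}| = 1 by apply/eqP; rewrite eqn_leq G1; case: connG.
  by rewrite /boundary -eqc c1 eqxx !inE.
have H_gt1 : 1 < #|{: H}| by rewrite -eqc.
have cf := iso_closer connG fb fm; have [g fK gK] := fb.
apply/(boundaryP connH _ H_gt1)/(boundaryP connG _ G_gt1) => -[u].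
  by rewrite -(gK u) (cf _ _).1 (cf _ _).2; exists (g u).
by rewrite -(cf _ _).1 -(cf _ _).2; exists (f u).
Qed.

Lemma iso_card_boundary (G H : sgraph) : connected G -> isomorphic G H ->
  #|boundary G| = #|boundary H|.
Proof.
move=> connG [f fb fm]; have [g fK gK] := fb.
rewrite -(card_imset _ (can_inj fK)); apply: eq_card => y; apply/imsetP/idP.
  by case=> x xb ->; rewrite (iso_boundary connG fb fm).
by exists (g y); rewrite ?gK // -(iso_boundary connG fb fm) gK.
Qed.

Lemma step_connected (G : sgraph) (D : G -> G -> nat) : 0 < #|{: G}| ->
  (forall x y, x != y -> exists2 z, edge x z & D x y = (D z y).+1) -> connected G.
Proof.
move=> G0 Dstep; split=> // x y.
have : D x y < (D x y).+1 by []. move: {2}(D x y).+1 => n.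
elim: n x => // n IHn x lt_n; have [->//|/Dstep[z xz Dz]] := eqVneq x y.
by apply: connect_trans (connect1 xz) (IHn _ _); rewrite Dz in lt_n.
Qed.

(** * Criteria for the boundary and for stability number 1 *)

Section Criteria.

Variable G : sgraph.
Hypotheses (connG : connected G) (G_gt1 : 1 < #|{: G}|).
Implicit Types (v u w : G).

Lemma boundary_crit v u w : edge v w -> dist w u < dist v u ->
  (forall w', edge v w' -> dist w' u <= dist v u) -> v \in boundary G.
Proof.
move=> vw wu no; apply/(boundaryP connG _ G_gt1); exists u.
have -> : farther v u = 0.
  apply/eqP; rewrite cards_eq0; apply/eqP/setP => z; rewrite !inE.
  by apply/negP => /andP[/no]; rewrite ltnNge => ->.
by apply/card_gt0P; exists w; rewrite !inE vw.
Qed.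

Lemma closer_le1 v u : (forall w w', edge v w -> edge v w' ->
  dist w u < dist v u -> dist w' u < dist v u -> w = w') -> closer v u <= 1.
Proof.
move=> uni; apply/card_le1_eqP => w w'; rewrite !inE => /andP[? ?] /andP[? ?].
exact: uni.
Qed.

Lemma nonboundary_crit v : (forall u w, edge v w -> dist w u < dist v u ->
    (forall w', edge v w' -> dist w' u < dist v u -> w' = w) /\
    exists2 w', edge v w' & dist v u < dist w' u) -> v \notin boundary G.
Proof.
move=> crit; apply/negP => /(boundaryP connG _ G_gt1)[u].
apply/negP; rewrite -leqNgt.
have [->//|] := posnP (closer v u).
case/card_gt0P => w; rewrite !inE => /andP[vw wu].
have [uni [w' vw' w'u]] := crit u w vw wu.
apply: (@leq_trans 1).
  by apply: closer_le1 => z z' ? ? ? ?; rewrite (uni z) // (uni z').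
by apply/card_gt0P; exists w'; rewrite !inE vw'.
Qed.

Lemma beta_eq v (n : int) : (forall u, (beta2 v u <= n)%R) ->
  (exists u, beta2 v u = n) -> beta v = n.
Proof.
move=> le_n [u un]; apply/eqP; rewrite eq_le; apply/andP; split.
  rewrite /beta; apply: (big_ind (fun m => (m <= n)%R)) => // m1 m2 h1 h2.
  by rewrite ge_max h1 h2.
by rewrite -un /beta (bigD1 u) //= le_max lexx.
Qed.

Lemma beta2_le v u : (beta2 v u <= beta v)%R.
Proof. by rewrite /beta (bigD1 u) //= le_max lexx. Qed.

Lemma attach_set_crit v : (forall u, closer v u <= (farther v u).+1) ->
  v \in boundary G -> v \in attach_set G.
Proof.
move=> le1 vb; rewrite inE vb /=; apply/eqP/beta_eq.
  by move=> u; rewrite (beta2E connG); have := le1 u; lia.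
have [u lt_u] := boundaryP connG _ G_gt1 vb.
by exists u; rewrite (beta2E connG); have := le1 u; lia.
Qed.

Lemma attach_set_closer v u : v \in attach_set G -> closer v u <= (farther v u).+1.
Proof.
by rewrite inE => /andP[_ /eqP bv]; have := beta2_le v u; rewrite (beta2E connG) bv; lia.
Qed.

End Criteria.

(** * Attached paths *)

Section Attach.

Variables (H : sgraph) (l : H -> nat).
Local Notation A := (attach l).
Implicit Types (x y u : A) (v w : H).

Definition att v (n : nat) : A := Tagged (fun v => 'I_(l v).+1) (inord n : 'I_(l v).+1).
Definition height x : nat := tagged x.

Lemma tag_att v n : tag (att v n) = v. Proof. by []. Qed.

Lemma height_att v n : n <= l v -> height (att v n) = n.
Proof. by move=> nl; rewrite /height /att /= inordK. Qed.

Lemma height_le x : height x <= l (tag x).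
Proof. by have := ltn_ord (tagged x); rewrite ltnS. Qed.

Lemma attK x : att (tag x) (height x) = x.
Proof. by case: x => v i; rewrite /att /height /= inord_val. Qed.

Lemma att_ind (P : A -> Prop) : (forall v n, n <= l v -> P (att v n)) -> forall x, P x.
Proof. by move=> Patt x; rewrite -(attK x); apply: Patt; apply: height_le. Qed.

Lemma att_eq x y : (x == y) = (tag x == tag y) && (height x == height y).
Proof.
apply/eqP/andP => [->|[/eqP t /eqP h]]; first by [].
by rewrite -(attK x) -(attK y) t h.
Qed.

Lemma attach_edge x y : edge x y =
  [&& height x == 0, height y == 0 & edge (tag x) (tag y)] ||
  (tag x == tag y) && ((height y == (height x).+1) || (height x == (height y).+1)).
Proof.
have -> : edge x y = (x != y) &&
  (([&& height x == 0, height y == 0 & edge (tag x) (tag y)]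
    || (tag x == tag y) && (height y == (height x).+1)) ||
   ([&& height y == 0, height x == 0 & edge (tag y) (tag x)]
    || (tag y == tag x) && (height x == (height y).+1))) by [].
rewrite att_eq (eq_sym (tag y) (tag x)) (edge_sym (tag y) (tag x)).
have [->|ne] := eqVneq (tag x) (tag y); first by rewrite edge_irrefl; lia.
by case: (edge _ _); lia.
Qed.

Lemma attach_nbr_pos v i y : 0 < i -> i <= l v -> edge (att v i) y ->
  y = att v i.-1 \/ (i < l v /\ y = att v i.+1).
Proof.
move=> i0 il; elim/att_ind: y => w j jl; rewrite attach_edge !tag_att !height_att //.
case/orP => [/and3P[]|/andP[/eqP vw]]; first by lia.
rewrite -{}vw in jl *; by case/orP => /eqP e; [right; rewrite -e | left; rewrite e].
Qed.

Hypothesis connH : connected H.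

Definition attach_dist x y : nat :=
  if tag x == tag y then (height x - height y) + (height y - height x)
  else height x + dist (tag x) (tag y) + height y.

Lemma attach_dist_step x y : x != y ->
  exists2 z, edge x z & attach_dist x y = (attach_dist z y).+1.
Proof.
elim/att_ind: x => v i il; elim/att_ind: y => w j jl.
rewrite att_eq !tag_att !height_att //; have [vw|vw] := eqVneq v w.
  move=> ij; rewrite -{}vw in jl *; have [lt_ij|lt_ji] := ltnP i j.
  - have il' : i.+1 <= l v by lia.
    by exists (att v i.+1); rewrite ?attach_edge /attach_dist !tag_att ?height_att // ?eqxx;
      lia.
  - have il' : i.-1 <= l v by lia.
    by exists (att v i.-1); rewrite ?attach_edge /attach_dist !tag_att ?height_att // ?eqxx;
      lia.
move=> _; have [i0|i0] := posnP i.
  have [v' vv' dv] := dist_step connH vw; exists (att v' 0).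
    by rewrite attach_edge !tag_att !height_att // i0 vv'.
  rewrite /attach_dist !tag_att !height_att // (negPf vw).
  have [v'w|v'w] := eqVneq v' w; last by lia.
  by rewrite v'w dist0 in dv; lia.
have il' : i.-1 <= l v by lia.
by exists (att v i.-1);
  rewrite ?attach_edge /attach_dist !tag_att ?height_att // ?eqxx ?(negPf vw); lia.
Qed.

Lemma attach_dist_le x y z : edge x z -> attach_dist x y <= (attach_dist z y).+1.
Proof.
elim/att_ind: x => v i il; elim/att_ind: y => w j jl; elim/att_ind: z => v' i' il'.
rewrite attach_edge /attach_dist !tag_att !height_att //.
case/orP => [/and3P[/eqP-> /eqP->]|/andP[/eqP->]]; last by case: (v' == w); lia.
move=> vv'; have := edge_dist1 connH vv'.
have [e|_] := eqVneq v w; have [e'|_] := eqVneq v' w; rewrite -?e -?e'; try lia.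
by have := dist_triangle connH v v' w; lia.
Qed.

Lemma dist_attach x y : dist x y = attach_dist x y.
Proof.
apply: (dist_unique (D := attach_dist^~ y)).
- by rewrite /attach_dist eqxx subnn.
- by move=> z z'; apply: attach_dist_le.
- by move=> z; apply: attach_dist_step.
Qed.

Lemma attach_connected : connected A.
Proof.
apply: (step_connected (D := attach_dist)); last exact: attach_dist_step.
by have /card_gt0P[v _] := connH.1; apply/card_gt0P; exists (att v 0).
Qed.

Hypothesis H_gt1 : 1 < #|{: H}|.

Lemma att0_inj : injective (att^~ 0).
Proof. by move=> v w /(congr1 tag). Qed.

Lemma attach_gt1 : 1 < #|{: A}|.
Proof. by apply: (leq_trans H_gt1); rewrite -(card_codom att0_inj) max_card. Qed.

Lemma closer_att0 v u : tag u != v -> closer (att v 0) u = closer v (tag u).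
Proof.
move=> uv; have vu : v != tag u by rewrite eq_sym.
rewrite /closer -(card_imset _ att0_inj); apply: eq_card => y.
rewrite !inE; apply/idP/imsetP => [|[w]].
  elim/att_ind: y => w j jl;
    rewrite attach_edge !dist_attach /attach_dist !tag_att !height_att //.
  rewrite (negPf vu) eqxx /= => /andP[/orP[/andP[/eqP j0 vw]|/andP[/eqP vw /orP[/eqP j1|//]]]].
    rewrite j0 => lt_w; exists w; rewrite // !inE vw /=.
    move: lt_w; have [->|] := eqVneq w (tag u); last by lia.
    by rewrite dist0 (dist_gt0 connH).
  by rewrite -vw (negPf vu) j1; lia.
rewrite !inE => /andP[vw lt_w] ->.
rewrite attach_edge !dist_attach /attach_dist !tag_att !height_att // vw /=.
by rewrite (negPf vu); have [e|_] := eqVneq w (tag u); move: lt_w; rewrite ?e ?dist0 /=; lia.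
Qed.

(** The first vertex of the attached path is the only new neighbour of [v], and it is farther from
    every target off that path. So an attached path lowers the excess by one, which takes [v] out of
    the boundary when beta is 1. *)
Lemma farther_att0 v u : tag u != v ->
  farther (att v 0) u = farther v (tag u) + (0 < l v).
Proof.
move=> uv; have vu : v != tag u by rewrite eq_sym.
rewrite /farther -(card_imset _ att0_inj).
set S := imset _ _.
have vw_dist w : edge v w -> dist v (tag u) < dist w (tag u) -> w != tag u.
  by move=> vw; apply: contraTneq => ->; rewrite dist0.
have [l0|l0] := posnP (l v).
  rewrite addn0; apply: eq_card => y; rewrite !inE; apply/idP/imsetP => [|[w]].
    elim/att_ind: y => w j jl;
      rewrite attach_edge !dist_attach /attach_dist !tag_att !height_att //.
    rewrite (negPf vu) eqxx /= => /andP[/orP[/andP[/eqP j0 vw]|/andP[/eqP vw /orP[/eqP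
      j1|//]]]].
      rewrite j0 => lt_w; exists w; rewrite // !inE vw /=.
      by move: lt_w; have [->|] := eqVneq w (tag u); lia.
    by rewrite -vw l0 j1 in jl.
  rewrite !inE => /andP[vw lt_w] ->.
  rewrite attach_edge !dist_attach /attach_dist !tag_att !height_att // vw /=.
  by rewrite (negPf vu) (negPf (vw_dist _ vw lt_w)) !add0n ltn_add2r.
have vS : att v 1 \notin S.
  by apply/imsetP => -[w _ /(congr1 height)]; rewrite !height_att.
(* The summand 1 is read as the truth value of [vS], so that [cardsU1] applies. *)
rewrite addnC -/(nat_of_bool true) -[in RHS]vS -cardsU1; apply: eq_card => y.
rewrite !inE; apply/idP/orP => [|[/eqP->|/imsetP[w]]].
- elim/att_ind: y => w j jl;
  rewrite attach_edge !dist_attach /attach_dist !tag_att !height_att //.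
  rewrite (negPf vu) eqxx /= => /andP[/orP[/andP[/eqP j0 vw]|/andP[/eqP vw /orP[/eqP j1|//]]]].
    rewrite j0 => lt_w; right; apply/imsetP; exists w; rewrite // !inE vw /=.
    by move: lt_w; have [->|] := eqVneq w (tag u); lia.
  by rewrite vw j1; left.
- rewrite attach_edge !dist_attach /attach_dist !tag_att !height_att // !eqxx /=.
  by rewrite (negPf vu) /=; lia.
rewrite !inE => /andP[vw lt_w] ->.
rewrite attach_edge !dist_attach /attach_dist !tag_att !height_att // vw /=.
by rewrite (negPf vu) (negPf (vw_dist _ vw lt_w)) !add0n ltn_add2r.
Qed.

Hypothesis l_supp : forall v, v \notin attach_set H -> l v = 0.

Lemma attach_boundary_pos v i : 0 < i -> i <= l v ->
  (att v i \in boundary A) = (i == l v).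
Proof.
move=> i0 il; have [e|ne] := eqVneq i (l v).
  apply: (boundary_crit attach_connected attach_gt1 (u := att v 0) (w := att v i.-1)).
  - by rewrite attach_edge !tag_att !height_att ?eqxx /=; lia.
  - by rewrite !dist_attach /attach_dist !tag_att !height_att ?eqxx; lia.
  move=> y /(attach_nbr_pos i0 il)[->|[]]; last by lia.
  by rewrite !dist_attach /attach_dist !tag_att !height_att ?eqxx; lia.
apply/negbTE/(nonboundary_crit attach_connected attach_gt1) => u y.
have lt_il : i < l v by lia.
have p_le : i.-1 <= l v by lia.
have D : (dist (att v i.-1) u).+1 = dist (att v i) u /\ dist (att v i.+1) u = (dist (att v i)
  u).+1 \/
   dist (att v i.-1) u = (dist (att v i) u).+1 /\ (dist (att v i.+1) u).+1 = dist (att v i) u \/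
   dist (att v i.-1) u = (dist (att v i) u).+1 /\ dist (att v i.+1) u = (dist (att v i) u).+1.
  by rewrite !dist_attach /attach_dist !tag_att !height_att //; case: (v == tag u); lia.
have xp : edge (att v i) (att v i.-1).
  by rewrite attach_edge !tag_att !height_att // eqxx /=; lia.
have xq : edge (att v i) (att v i.+1).
  by rewrite attach_edge !tag_att !height_att // !eqxx orbT.
case/(attach_nbr_pos i0 il) => [->|[_ ->]] lt_y.
  split; last by exists (att v i.+1); [exact: xq | slia].
  by move=> w /(attach_nbr_pos i0 il)[//|[_ ->]]; slia.
split; last by exists (att v i.-1); [exact: xp | slia].
by move=> w /(attach_nbr_pos i0 il)[->|[_ ->] //]; slia.
Qed.

Lemma attach_boundary0 v : (att v 0 \in boundary A) = (v \in boundary H) && (l v == 0).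
Proof.
have [l0|l0] := posnP (l v).
  rewrite andbT.
  apply/(boundaryP attach_connected _ attach_gt1)/(boundaryP connH _ H_gt1) => -[u].
    have [uv|uv] := eqVneq (tag u) v.
      have -> : u = att v 0.
        by apply/eqP; rewrite att_eq uv tag_att height_att // eqxx; have := height_le u;
          rewrite uv l0; lia.
      by rewrite closer_self.
    by rewrite closer_att0 // farther_att0 // l0 addn0; exists (tag u).
  have [->|uv] := eqVneq u v => lt_u.
    by rewrite closer_self in lt_u.
  by exists (att u 0); rewrite closer_att0 // farther_att0 // l0 addn0.
rewrite andbF; apply/negP => /(boundaryP attach_connected _ attach_gt1)[u].
apply/negP; rewrite -leqNgt.
have va : v \in attach_set H by apply: contraLR l0 => /l_supp->.
(* Towards a target off the path, the new farther neighbour cancels the excess of at most 1. Towards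
   a target on the path only [att v 1] is closer, and any neighbour within [H] is farther. *)
have [uv|uv] := eqVneq (tag u) v; last first.
  by rewrite closer_att0 // farther_att0 // l0 addn1; apply: attach_set_closer.
have dv0 := deg_gt0 connH v H_gt1.
have [v' vv'] : exists v', edge v v' by case/card_gt0P: dv0 => v'; rewrite inE; exists v'.
have nv' : v' != v by rewrite eq_sym; apply: edge_neq.
have [h0|h0] := posnP (height u).
  have -> : u = att v 0 by apply/eqP; rewrite att_eq uv tag_att height_att // h0 !eqxx.
  by rewrite closer_self.
apply: (@leq_trans 1).
  apply: closer_le1 => w w'.
  suff uni y : edge (att v 0) y -> dist y u < dist (att v 0) u -> y = att v 1.
    by move=> vw vw' lw lw'; rewrite (uni w) // (uni w').
  elim/att_ind: y => y j jl;
    rewrite attach_edge !dist_attach /attach_dist !tag_att !height_att // uv eqxx /=.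
  case/orP => [/andP[/eqP-> vy]|/andP[/eqP <- /orP[/eqP-> //|//]]].
  by have := edge_neq vy; rewrite eq_sym => /negPf->; rewrite eqxx /=; lia.
apply/card_gt0P; exists (att v' 0); rewrite !inE attach_edge !dist_attach /attach_dist.
by rewrite !tag_att !height_att // uv (negPf nv') !eqxx vv' /=; have := edge_dist1 connH vv';
  rewrite dist_sym //; lia.
Qed.

Lemma attach_boundary x :
  (x \in boundary A) = (tag x \in boundary H) && (height x == l (tag x)).
Proof.
elim/att_ind: x => v i il; rewrite tag_att height_att //.
have [->|i0] := posnP i; first by rewrite attach_boundary0 eq_sym.
rewrite attach_boundary_pos //; have va : v \in attach_set H.
  by apply: contraLR i0 => /l_supp; lia.
by move: va; rewrite inE => /andP[-> _].
Qed.

Lemma card_attach_boundary : #|boundary A| = #|boundary H|.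
Proof.
have inj : injective (fun v => att v (l v)) by move=> v w /(congr1 tag).
rewrite -(card_imset _ inj); apply: eq_card => x; rewrite attach_boundary.
apply/andP/imsetP => [[xb /eqP h]|[v vb ->]].
  by exists (tag x); rewrite // -h attK.
by rewrite tag_att height_att // eqxx.
Qed.

(** This allows the path ending at [x] to be lengthened. Only length 0 is at stake, since a positive
    length already lies in the support of [l]. *)
Lemma attach_grow x : x \in boundary A ->
  (forall u, closer x u <= (farther x u).+1) -> tag x \in attach_set H.
Proof.
rewrite attach_boundary => /andP[vb /eqP h] le1.
have [l0|l0] := posnP (l (tag x)); last first.
  by apply: contraLR l0 => /l_supp->.
have e : x = att (tag x) 0 by rewrite -l0 -h attK.
apply: (attach_set_crit connH H_gt1) => // u.
have [->|uv] := eqVneq u (tag x).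
  by rewrite closer_self.
have := le1 (att u 0); rewrite [in closer _ _]e [in farther _ _]e.
by rewrite closer_att0 // farther_att0 // l0 addn0.
Qed.

End Attach.

(** * Deleting a leaf *)

(** [c x] is the base vertex and [h x] the height on the path attached there; such coordinates
    replace a map into the dependent pairs of [attach l]. *)
Lemma coded_isomorphic (G H : sgraph) (l : H -> nat) (c : G -> H) (h : G -> nat) :
  (forall x, h x <= l (c x)) ->
  (forall x y, c x = c y -> h x = h y -> x = y) ->
  (forall v n, n <= l v -> exists2 x, c x = v & h x = n) ->
  (forall x y, edge x y = [&& h x == 0, h y == 0 & edge (c x) (c y)] ||
    (c x == c y) && ((h y == (h x).+1) || (h x == (h y).+1))) ->
  isomorphic G (attach l).
Proof.
move=> hl c_inj c_surj c_edge; apply: isomorphic_sym.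
apply: (isomorphic_inv (f := fun x => att l (c x) (h x))).
- move=> x y e; apply: c_inj; first exact: (congr1 (@tag _ _) e).
  by have := congr1 (@height _ l) e; rewrite !height_att.
- elim/att_ind => v n nl; have [x <- <-] := c_surj v n nl; by exists x.
- by move=> x y; rewrite attach_edge !height_att // c_edge.
Qed.

Lemma attach0_isomorphic (H : sgraph) : isomorphic H (attach (fun _ : H => 0)).
Proof.
apply: (@coded_isomorphic _ _ _ id (fun _ => 0)) => //.
  by move=> v n; rewrite leqn0 => /eqP->; exists v.
by move=> x y; rewrite /= andbF orbF.
Qed.

Section DelVertex.

Variables (G : sgraph) (b : G).

Let del_edge_rel : rel {x : G | x != b} := [rel x y | edge (val x) (val y)].

Fact del_vertex_sym : symmetric del_edge_rel.
Proof. by move=> x y; apply: edge_sym. Qed.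

Fact del_vertex_irrefl : irreflexive del_edge_rel.
Proof. by move=> x; apply: edge_irrefl. Qed.

Definition del_vertex : sgraph := SGraph del_vertex_sym del_vertex_irrefl.

End DelVertex.

Section Leaf.

Variables (G : sgraph) (b c : G).
Hypotheses (connG : connected G) (bc : edge b c) (leaf_b : forall w, edge b w -> w = c).
Local Notation G' := (del_vertex b).
Implicit Types (x y u : G').

Definition in_del v (vb : v != b) : G' := exist (fun v : G => v != b) v vb.

Lemma leaf_nbr_neq : c != b. Proof. by rewrite eq_sym; apply: edge_neq. Qed.

Definition del_c : G' := in_del leaf_nbr_neq.

Lemma card_del_vertex : #|{: G}| = #|{: G'}|.+1.
Proof.
have b0 : 0 < #|{: G}| by apply/card_gt0P; exists b.
have -> : #|{: G'}| = #|predC1 b| by rewrite card_sig; apply: eq_card.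
by rewrite cardC1 prednK.
Qed.

Lemma dist_leaf v : v != b -> dist b v = (dist c v).+1.
Proof.
by rewrite eq_sym => /(dist_step connG)[z /leaf_b -> ->].
Qed.

Lemma del_step x y : x != y ->
  exists2 z : G', edge x z & dist (val x) (val y) = (dist (val z) (val y)).+1.
Proof.
rewrite -val_eqE => /(dist_step connG)[z xz dz].
have zb : z != b.
  apply/eqP => zb; move: xz dz; rewrite zb edge_sym => /leaf_b -> .
  by rewrite (dist_leaf (valP y)) /=; lia.
by exists (in_del zb).
Qed.

Lemma dist_del x y : dist x y = dist (val x) (val y).
Proof.
apply: (@dist_unique G' y (fun x => dist (val x) (val y))).
- exact: dist0.
- by move=> z z' zz'; apply: (dist_edge_r connG).
- by move=> z; apply: del_step.
Qed.

Lemma del_connected : connected G'.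
Proof.
apply: (step_connected (D := fun x y => dist (val x) (val y))); last exact: del_step.
by apply/card_gt0P; exists del_c.
Qed.

Hypothesis G'_gt1 : 1 < #|{: G'}|.

Let G_gt1 : 1 < #|{: G}|.
Proof. by rewrite card_del_vertex; apply: ltnW. Qed.

Lemma closer_del x u : closer (val x) (val u) = closer x u.
Proof.
rewrite /closer -(card_imset _ val_inj); apply: eq_card => w; rewrite !inE.
apply/andP/imsetP => [[xw lw]|[z]].
  have wb : w != b.
    apply/eqP => wb; move: xw lw; rewrite wb edge_sym => /leaf_b ->.
    by rewrite (dist_leaf (valP u)) /=; lia.
  by exists (in_del wb); rewrite // !inE !dist_del lw andbT.
by rewrite !inE !dist_del => /andP[xz lz] ->.
Qed.

(** Seen from [c], the leaf is farther from every vertex other than itself, so deleting it costs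
    [c], and only [c], one farther neighbour. *)
Lemma farther_del x u :
  farther (val x) (val u) = farther x u + (val x == c).
Proof.
rewrite /farther -(card_imset _ val_inj); set S := imset _ _.
have in_S w : (w \in S) = [&& w != b, edge (val x) w & dist (val x) (val u) < dist w (val u)].
  apply/imsetP/and3P => [[z]|[wb xw lw]].
    by rewrite !inE !dist_del => /andP[xz lz] ->; split=> //; exact: (valP z).
  by exists (in_del wb); rewrite // !inE !dist_del lw andbT.
have [xc|xc] := eqVneq (val x) c.
  have bS : b \notin S by rewrite in_S eqxx.
  rewrite addnC -/(nat_of_bool true) -[in RHS]bS -cardsU1; apply: eq_card => w.
  rewrite !inE in_S; have [->|wb] /= := eqVneq w b; last by [].
  by rewrite xc edge_sym bc (dist_leaf (valP u)) ltnSn.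
rewrite addn0; apply: eq_card => w; rewrite !inE in_S.
have [->|wb] //= := eqVneq w b.
by apply/negbTE/negP => /andP[]; rewrite edge_sym => /leaf_b/(elimN eqP xc).
Qed.

Lemma leaf_in_boundary : b \in boundary G.
Proof.
apply: (boundary_crit connG G_gt1 (u := c) bc);
  rewrite ?dist0 ?(dist_gt0 connG) 1?eq_sym ?leaf_nbr_neq //.
by move=> w /leaf_b ->; rewrite dist0.
Qed.

Lemma dist_to_leaf v : v != b -> dist v b = (dist v c).+1.
Proof. by move=> vb; rewrite (dist_sym connG) dist_leaf // (dist_sym connG). Qed.

(** Every vertex but [b] is one step farther from [b] than from [c], so the target [b] can be
    replaced by [c] when [b] is not a neighbour. *)
Lemma boundary_del x : val x != c -> (val x \in boundary G) = (x \in boundary G').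
Proof.
move=> xc; have xb : val x != b := valP x.
apply/(boundaryP connG _ G_gt1)/(boundaryP del_connected _ G'_gt1) => -[u].
  have [->|ub] := eqVneq u b.
    have nb w : edge (val x) w -> w != b.
      by apply: contraTneq => ->; rewrite edge_sym; apply/negP => /leaf_b/(elimN eqP xc).
    have -> : closer (val x) b = closer (val x) (val del_c).
      apply: eq_card => w; rewrite !inE; case xw: (edge _ w) => //=.
      by rewrite (dist_to_leaf (nb _ xw)) (dist_to_leaf xb) ltnS.
    have -> : farther (val x) b = farther (val x) (val del_c).
      apply: eq_card => w; rewrite !inE; case xw: (edge _ w) => //=.
      by rewrite (dist_to_leaf (nb _ xw)) (dist_to_leaf xb) ltnS.
    by rewrite closer_del farther_del (negPf xc) addn0; exists del_c.
  rewrite -[u]/(val (in_del ub)) closer_del farther_del (negPf xc) addn0.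
  by exists (in_del ub).
by exists (val u); rewrite closer_del farther_del (negPf xc) addn0.
Qed.

(** The leaf counts as one farther neighbour, so an excess of 2 must be available without it. The
    target [b] gives nothing: [b] is then the only closer neighbour and any other neighbour is
    farther. *)
Lemma boundary_del_c :
  c \in boundary G <-> exists u, (farther del_c u).+1 < closer del_c u.
Proof.
split=> [/(boundaryP connG _ G_gt1)[u]|[u lt_u]].
  have [->|ub] := eqVneq u b.
    move=> lt_b; exfalso; move: lt_b; apply/negP; rewrite -leqNgt.
    apply: (@leq_trans 1).
      apply: closer_le1 => w w' _ _.
      suff uni z : dist z b < dist c b -> z = b by move=> /uni -> /uni ->.
      rewrite (dist_sym connG c) (edge_dist1 connG bc) ltnS leqn0 (dist_eq0 connG).
      by move/eqP.
    have := deg_gt0 del_connected del_c G'_gt1.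
    case/card_gt0P => z; rewrite inE => cz; apply/card_gt0P; exists (val z).
    rewrite !inE; apply/andP; split; first exact: cz.
    rewrite !dist_to_leaf ?leaf_nbr_neq ?(valP z) // dist0 ltnS (dist_gt0 connG).
    by rewrite eq_sym; apply: edge_neq cz.
  rewrite -[u]/(val (in_del ub)) -[c]/(val del_c) closer_del farther_del eqxx addn1.
  by exists (in_del ub).
apply/(boundaryP connG _ G_gt1); exists (val u).
by rewrite -[c]/(val del_c) closer_del farther_del eqxx addn1.
Qed.

Lemma card_boundary_del_same : del_c \in boundary G' ->
  (forall u, closer del_c u <= (farther del_c u).+1) -> #|boundary G| = #|boundary G'|.
Proof.
move=> leaf_nbr_neq' le1.
have cN : c \notin boundary G.
  by apply/negP => /boundary_del_c[u]; rewrite ltnNge le1.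
rewrite (cardsD1 b) leaf_in_boundary [RHS](cardsD1 del_c) leaf_nbr_neq'; congr (_ + _).
rewrite -[RHS](card_imset _ val_inj); apply: eq_card => w; rewrite !inE.
apply/andP/imsetP => [[wb wB]|[z]].
  exists (in_del wb) => //; rewrite !inE -boundary_del /=.
    by rewrite wB andbT -val_eqE /=; apply: contraTneq wB => ->.
  by apply: contraTneq wB => ->.
rewrite !inE -val_eqE /= => /andP[zc zB] ->; split; first exact: (valP z).
by rewrite boundary_del.
Qed.

(** If [c] is outside the smaller boundary or has excess 2 there, its membership survives the
    addition of [b], so [b] comes on top. *)
Lemma card_boundary_del_succ :
  ~ (del_c \in boundary G' /\ forall u, closer del_c u <= (farther del_c u).+1) ->
  #|boundary G| = #|boundary G'|.+1.
Proof.
move=> nsame; rewrite (cardsD1 b) leaf_in_boundary; congr (_.+1).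
rewrite -[RHS](card_imset _ val_inj); apply: eq_card => w; rewrite !inE.
have cE : (c \in boundary G) = (del_c \in boundary G').
  apply/idP/idP => [/boundary_del_c[u lt_u]|cB].
    by apply/(boundaryP del_connected _ G'_gt1); exists u; apply: ltnW.
  apply/boundary_del_c;
    have [/existsP//|no] := boolP [exists u, (farther del_c u).+1 < closer del_c u].
  case: nsame; split; first exact: cB.
  move=> u; rewrite leqNgt; apply: contra no => lt_u.
  by apply/existsP; exists u.
have BE z : (val z \in boundary G) = (z \in boundary G').
  have [zc|zc] := eqVneq (val z) c; last exact: boundary_del.
  by have -> : z = del_c by apply: val_inj.
apply/andP/imsetP => [[wb wB]|[z zB ->]]; last by rewrite BE (valP z).
by exists (in_del wb); rewrite // -BE.
Qed.

End Leaf.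

(** * Adding a leaf *)

Section LeafGrow.

Variables (G : sgraph) (b c : G).
Hypotheses (connG : connected G) (bc : edge b c) (leaf_b : forall w, edge b w -> w = c).
Local Notation G' := (del_vertex b).
Local Notation c' := (del_c bc).

Lemma del_vertexP (x : G) : x = b \/ exists x' : G', x = val x'.
Proof. by have [->|xb] := eqVneq x b; [left | right; exists (in_del xb)]. Qed.

Lemma insub_b : insub b = None :> option G'.
Proof. by apply: insubF; rewrite eqxx. Qed.

Lemma insub_del (x' : G') : insub (val x') = Some x' :> option G'.
Proof. exact: valK. Qed.

Lemma edge_b (x' : G') : edge b (val x') = (x' == c').
Proof.
rewrite -val_eqE /=; apply/idP/eqP => [/leaf_b //|e].
by rewrite /= e.
Qed.

Lemma edge_bb : edge b b = false. Proof. exact: edge_irrefl. Qed.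

Lemma grow_isomorphic (H : sgraph) (l : H -> nat) (f : G' -> attach l) :
  bijective f -> {mono f : x y / edge x y} ->
  height (f c') = l (tag (f c')) ->
  isomorphic G (attach (fun w => l w + (w == tag (f c')))).
Proof.
move=> fb fm hc; set v := tag (f c').
(* [insub] fails exactly at [b]; the default values place the leaf one step beyond the end of the
   path at [v]. *)
pose t x := if insub x is Some x' then tag (f x' : attach l) else v.
pose h x := if insub x is Some x' then height (f x') else (l v).+1.
have tb : t b = v by rewrite /t insub_b.
have hb : h b = (l v).+1 by rewrite /h insub_b.
have tv x' : t (val x') = tag (f x') by rewrite /t insub_del.
have hv x' : h (val x') = height (f x') by rewrite /h insub_del.
have c_edge x' : edge b (val x') = (v == tag (f x')) && (l v == height (f x')).
  by rewrite edge_b -(inj_eq (bij_inj fb)) att_eq hc eq_sym [X in _ && X]eq_sym.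
apply: (@coded_isomorphic G H _ t h).
- move=> x; case: (del_vertexP x) => [->|[x' ->]].
    by rewrite tb hb eqxx addn1.
  by rewrite tv hv; apply: leq_trans (height_le _) (leq_addr _ _).
- move=> x y; case: (del_vertexP x) => [->|[x' ->]]; case: (del_vertexP y) => [->|[y' ->]] //.
  + rewrite tb hb tv hv => e; have := height_le (f y'); rewrite -e; lia.
  + rewrite tb hb tv hv => e; have := height_le (f x'); rewrite e; lia.
  rewrite !tv !hv => e1 e2; congr val; apply: (bij_inj fb); apply/eqP.
  by rewrite att_eq e1 e2 !eqxx.
- move=> w n nl; have [nl'|nl'] := leqP n (l w).
    have [g fK gK] := fb; exists (val (g (att l w n))); first by rewrite tv gK.
    by rewrite hv gK height_att.
  have wv : w = v by apply/eqP; move: nl; case: eqP => // _; lia.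
  by exists b; rewrite ?tb ?hb //; move: nl nl'; rewrite wv eqxx; lia.
- move=> x y; case: (del_vertexP x) => [->|[x' ->]]; case: (del_vertexP y) => [->|[y' ->]].
  + by rewrite edge_bb hb tb eqxx; lia.
  + rewrite c_edge tb hb tv hv /=; have := height_le (f y').
    by have [<-|] := eqVneq v (tag (f y')); lia.
  + rewrite edge_sym c_edge tb hb tv hv /= andbF /= [tag _ == v]eq_sym;
    have := height_le (f x').
    by have [<-|] := eqVneq v (tag (f x')); lia.
  by rewrite !tv !hv -attach_edge fm.
Qed.

Lemma obtained_grow (H : sgraph) : connected H -> 1 < #|{: H}| -> 1 < #|{: G'}| ->
  obtained_from H G' -> c' \in boundary G' ->
  (forall u, closer c' u <= (farther c' u).+1) -> obtained_from H G.
Proof.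
move=> connH H_gt1 G'_gt1 [l [l_supp [f fb fm]]] cB le1.
have connG' := del_connected connG bc leaf_b.
have fB : f c' \in boundary (attach l) by rewrite (iso_boundary connG' fb fm).
have := fB; rewrite (attach_boundary connH H_gt1 l_supp) => /andP[_ /eqP hc].
exists (fun w => l w + (w == tag (f c'))); split; last exact: grow_isomorphic.
move=> w wN; rewrite (l_supp w wN); case: eqP => // e; case/negP: wN; rewrite e.
apply: (attach_grow connH H_gt1 l_supp fB) => u.
have [g fK gK] := fb; rewrite -(gK u) (iso_closer connG' fb fm _ _).1.
by rewrite (iso_closer connG' fb fm _ _).2.
Qed.

Lemma edge_complete n (x y : complete_graph n) : edge x y = (x != y).
Proof. by rewrite /= andbT. Qed.

(** The leaf hangs at height [i] of the leg at [v], before its end. The leg up to height [i] becomes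
    the path from m to m', the other two triangle vertices are a and b, the next leg vertex is c
    with [l v - i.+1] vertices attached, and the leaf is d. *)
Lemma tripod_grow (l : complete_graph 3 -> nat) (f : G' -> attach l) v i :
  bijective f -> {mono f : x y / edge x y} ->
  tag (f c') = v -> height (f c') = i -> i < l v ->
  exists2 l' : H7 i -> nat, (forall t, l' (inr t) = 0) & isomorphic G (attach l').
Proof.
move=> fb fm ev ei il.
have [v1 [v2 [v1v v2v v12 vall]]] : exists v1 v2 : complete_graph 3,
  [/\ v1 != v, v2 != v, v1 != v2 & forall w, [\/ w = v, w = v1 | w = v2]].
  pose o n (H : n < 3) : complete_graph 3 := Ordinal H.
  have cases w : [\/ w = o 0 isT, w = o 1 isT | w = o 2 isT].
    case: w => [[|[|[|n]]] wn] //; [constructor 1|constructor 2|constructor 3]; exact: val_inj.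
  case: (cases v) => ->;
    [exists (o 1 isT), (o 2 isT) | exists (o 0 isT), (o 2 isT) | exists (o 0 isT), (o 1 isT)];
    split=> // w; case: (cases w) => ->; by [constructor 1|constructor 2|constructor 3].
have [vv1 vv2 v21] : [/\ v != v1, v != v2 & v2 != v1] by split; rewrite eq_sym.
pose o4 n (H : n < 4) : 'I_4 := Ordinal H.
pose l' (a : H7 i) := match a with
  | inl k => if k == 0 :> nat then l v1 else if k == 1 :> nat then l v2
             else if k == 2 :> nat then l v - i.+1 else 0
  | inr _ => 0 end.
pose tx (x' : G') : H7 i := let w := tag (f x' : attach l) in let j := height (f x') in
  if w == v1 then inl (@o4 0 isT) else if w == v2 then inl (@o4 1 isT)
  else if j <= i then inr (inord j) else inl (@o4 2 isT).
pose hx (x' : G') := let w := tag (f x' : attach l) in let j := height (f x') in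
  if (w == v1) || (w == v2) then j else if j <= i then 0 else j - i.+1.
pose t x := if insub x is Some x' then tx x' else inl (@o4 3 isT).
pose h x := if insub x is Some x' then hx x' else 0.
exists l' => //.
pose P x (w : complete_graph 3) (j : nat) := exists2 x' : G', x = val x' & tag (f x') = w /\
  height (f x') = j.
have spec x : (x = b /\ t x = inl (@o4 3 isT) /\ h x = 0) \/
  (exists2 j, j <= l v1 & P x v1 j /\ t x = inl (@o4 0 isT) /\ h x = j) \/
  (exists2 j, j <= l v2 & P x v2 j /\ t x = inl (@o4 1 isT) /\ h x = j) \/
  (exists j : 'I_i.+1, P x v j /\ t x = inr j /\ h x = 0) \/
  (exists2 j, i < j <= l v & P x v j /\ t x = inl (@o4 2 isT) /\ h x = j - i.+1).
  rewrite /t /h; case: (del_vertexP x) => [->|[x' ->]]; first by left; rewrite insub_b.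
  rewrite insub_del /tx /hx; have hl := height_le (f x'); right.
  case: (vall (tag (f x'))) => e; rewrite e ?eqxx in hl *.
  - rewrite (negPf vv1) (negPf vv2) /=; right; right.
    have [ji|ij] := leqP (height (f x')) i.
      left; exists (inord (height (f x'))); split=> //; exists x' => //.
      by rewrite inordK.
    right; exists (height (f x')); first by rewrite ij.
    by split=> //; exists x'.
  - by left; exists (height (f x')) => //; split=> //; exists x'.
  - right; left; rewrite (negPf v21) orbT.
    by exists (height (f x')) => //; split=> //; exists x'.
have P_inj x y w j : P x w j -> P y w j -> x = y.
  case=> x' -> [e1 e2] [y' -> [e3 e4]]; congr val; apply: (bij_inj fb); apply/eqP.
  by rewrite att_eq e1 e2 e3 e4 !eqxx.
have P_surj w j : j <= l w -> exists x', tag (f x') = w /\ height (f x') = j.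
  by move=> jl; have [g fK gK] := fb; exists (g (att l w j)); rewrite gK height_att.
have P_edge x y w j w' j' : P x w j -> P y w' j' -> edge x y =
   [&& j == 0, j' == 0 & w != w'] || (w == w') && ((j' == j.+1) || (j == j'.+1)).
  case=> x' -> [e1 e2] [y' -> [e3 e4]].
  have -> : edge (val x') (val y') = edge (f x') (f y') by rewrite fm.
  by rewrite attach_edge e1 e2 e3 e4 edge_complete.
have Pb_edge y w j : P y w j -> edge b y = (w == v) && (j == i).
  by case=> y' -> [e1 e2]; rewrite edge_b -(inj_eq (bij_inj fb)) att_eq e1 e2 ev ei.
apply: (@coded_isomorphic G (H7 i) l' t h).
- move=> x; case: (spec x) => [[_ [-> ->]]|[[j jl [_ [-> ->]]]|[[j jl [_ [-> ->]]]|[[j [_ [->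
  ->]]]|[j jl [_ [-> ->]]]]]]] //=.
  by rewrite /l' /=; lia.
- move=> x y.
  case: (spec x) => [[ex [-> ->]]|[[j jl [Px [-> ->]]]|[[j jl [Px [-> ->]]]|[[j [Px [->
    ->]]]|[j jl [Px [-> ->]]]]]]];
  case: (spec y) => [[ey [-> ->]]|[[k kl [Py [-> ->]]]|[[k kl [Py [-> ->]]]|[[k [Py [->
    ->]]]|[k kl [Py [-> ->]]]]]]] //.
  + by rewrite ex ey.
  + by move=> _ e; rewrite e in Px; apply: P_inj Px Py.
  + by move=> _ e; rewrite e in Px; apply: P_inj Px Py.
  + by case=> e _; rewrite e in Px; apply: P_inj Px Py.
  + move=> _ e; have jk : j = k by lia.
    by rewrite jk in Px; apply: P_inj Px Py.
- case=> [[[|[|[|[|k]]]] kl] n|s n] //; rewrite /l' /= => nl.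
  + have [x' [e1 e2]] := P_surj v1 n nl; exists (val x');
    rewrite /t /h insub_del /tx /hx e1 e2 eqxx //.
    by congr inl; apply: val_inj.
  + have [x' [e1 e2]] := P_surj v2 n nl; exists (val x');
    rewrite /t /h insub_del /tx /hx e1 e2 (negPf v21) eqxx //.
    by congr inl; apply: val_inj.
  + have nl' : n + i.+1 <= l v by lia.
    have [x' [e1 e2]] := P_surj v _ nl'; exists (val x');
      rewrite /t /h insub_del /tx /hx e1 e2 (negPf vv1) (negPf vv2) /=.
      have -> : (n + i.+1 <= i) = false by lia.
      by congr inl; apply: val_inj.
    have -> : (n + i.+1 <= i) = false by lia.
    by lia.
  + exists b; rewrite /t /h insub_b; last by lia.
    by congr inl; apply: val_inj.
  + have si : s <= i by have := ltn_ord s.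
    have sl : s <= l v by lia.
    have [x' [e1 e2]] := P_surj v _ sl; exists (val x');
      rewrite /t /h insub_del /tx /hx e1 e2 (negPf vv1) (negPf vv2) si /=.
      by rewrite inord_val.
    by lia.
- move=> x y; rewrite -fork_dist_eq1 /fork_dist.
  case: (spec x) => [[ex [-> ->]]|[[j jl [Px [-> ->]]]|[[j jl [Px [-> ->]]]|[[j [Px [->
    ->]]]|[j jl [Px [-> ->]]]]]]];
  case: (spec y) => [[ey [-> ->]]|[[k kl [Py [-> ->]]]|[[k kl [Py [-> ->]]]|[[k [Py [->
    ->]]]|[k kl [Py [-> ->]]]]]]].
  all: rewrite ?eq_inl ?eq_inr ?ex ?ey /=.
  all: try rewrite (P_edge _ _ _ _ _ _ Px Py).
  all: try rewrite edge_irrefl.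
  all: try rewrite (Pb_edge _ _ _ Py).
  all: try rewrite edge_sym (Pb_edge _ _ _ Px).
  all: rewrite ?eqxx ?(negPf vv1) ?(negPf vv2) ?(negPf v21) ?(negPf v12) ?(negPf v1v) ?(negPf
    v2v) /=.
  all: try have := ltn_ord j; try have := ltn_ord k.
  all: clear P_edge Pb_edge spec P_inj P_surj fb fm ev ei vall.
  all: by repeat (case: ifP => ?); slia.
Qed.

End LeafGrow.

(** * Boundaries of the graphs Hi *)

Section Enumerated.

Variables (H : sgraph) (s : seq H) (D : H -> H -> nat).

(** Counts over an explicit list with an explicit distance table replace [#|_|] and [dist], so that
    [vm_compute] can decide the closed instances. *)
Definition count_closer v u := count (fun w => edge v w && (D w u < D v u)) s.
Definition count_farther v u := count (fun w => edge v w && (D v u < D w u)) s.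

(** The hypotheses of [dist_unique], for all targets at once, as a boolean. *)
Definition dist_check : bool :=
  all (fun x => (D x x == 0) && all (fun y =>
    ((x == y) || has (fun z => edge x z && (D x y == (D z y).+1)) s) &&
    all (fun z => edge x z ==> (D x y <= (D z y).+1)) s) s) s.

Definition beta_check v n : bool :=
  all (fun u => count_closer v u <= count_farther v u + n) s && has (fun u => count_closer v
    u == count_farther v u + n) s.

Definition enumerated : Prop :=
  [/\ uniq s, forall x, x \in s, 1 < size s & dist_check].

Hypothesis E : enumerated.

Let s_uniq : uniq s. Proof. by case: E. Qed.
Let s_all x : x \in s. Proof. by case: E. Qed.
Let s_gt1 : 1 < size s. Proof. by case: E. Qed.
Let chk : dist_check. Proof. by case: E. Qed.

Lemma card_count (A : {set H}) : #|A| = count [in A] s.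
Proof.
rewrite -size_filter -(card_uniqP (filter_uniq _ s_uniq)); apply: eq_card => x.
by rewrite mem_filter s_all andbT.
Qed.

Let stepH x y : x != y -> exists2 z, edge x z & D x y = (D z y).+1.
Proof.
move=> xy; have /allP/(_ x (s_all x))/andP[_ /allP/(_ y (s_all y))/andP[]] := chk.
by rewrite (negPf xy) => /hasP[z _ /andP[xz /eqP e]]; exists z.
Qed.

Lemma enum_dist x y : dist x y = D x y.
Proof.
apply: (dist_unique (D := D^~ y)).
- by have /allP/(_ y (s_all y))/andP[/eqP] := chk.
- move=> a z az; have /allP/(_ a (s_all a))/andP[_ /allP/(_ y (s_all y))/andP[_]] := chk.
  by move=> /allP/(_ z (s_all z)); rewrite az.
- by move=> a; apply: stepH.
Qed.

Lemma enum_card : #|{: H}| = size s.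
Proof. by rewrite -(card_uniqP s_uniq); apply: eq_card => x; rewrite s_all. Qed.

Lemma enum_connected : connected H.
Proof. by apply: (step_connected (D := D)) stepH; rewrite enum_card; apply: ltnW. Qed.

Lemma enum_closer v u : closer v u = count_closer v u.
Proof.
rewrite /closer card_count; apply: eq_count => w.
by rewrite /= !inE !enum_dist.
Qed.

Lemma enum_farther v u : farther v u = count_farther v u.
Proof.
rewrite /farther card_count; apply: eq_count => w.
by rewrite /= !inE !enum_dist.
Qed.

Lemma enum_boundary v : (v \in boundary H) = has (fun u => count_farther v u < count_closer v u) s.
Proof.
have H_gt1 : 1 < #|{: H}| by rewrite enum_card.
apply/(boundaryP enum_connected _ H_gt1)/hasP => -[u].
  by rewrite enum_closer enum_farther; exists u.
by move=> _ lt_u; exists u; rewrite enum_closer enum_farther.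
Qed.

Lemma enum_beta v n : beta_check v n -> beta v = n%:Z%R.
Proof.
case/andP => /allP le_n /hasP[u _ /eqP e]; apply: beta_eq.
  move=> w; have := le_n w (s_all w).
  by rewrite (beta2E enum_connected) enum_closer enum_farther; lia.
by exists u; rewrite (beta2E enum_connected) enum_closer enum_farther e; lia.
Qed.

Lemma enum_deg v : deg v = count (edge v) s.
Proof. by rewrite /deg card_count; apply: eq_count => w; rewrite /= inE. Qed.

Lemma enum_forall (P : H -> bool) : all P s -> forall v, P v.
Proof. by move=> /allP sP v; apply: sP. Qed.

End Enumerated.

Definition ords4 : seq 'I_4 :=
  [:: @Ordinal 4 0 isT; @Ordinal 4 1 isT; @Ordinal 4 2 isT; @Ordinal 4 3 isT].

Lemma ords4_all i : i \in ords4.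
Proof. by ord4_cases i. Qed.

Definition wheel_list : seq (option 'I_4) := None :: map some ords4.

Lemma wheel_list_all a : a \in wheel_list.
Proof. by case: a => [i|] //; ord4_cases i. Qed.

Definition ords3 : seq 'I_3 := [:: @Ordinal 3 0 isT; @Ordinal 3 1 isT; @Ordinal 3 2 isT].
Lemma ords3_all i : i \in ords3.
Proof. by case: i => [[|[|[|?]]] ?]. Qed.

Definition ords2 : seq 'I_2 := [:: @Ordinal 2 0 isT; @Ordinal 2 1 isT].
Lemma ords2_all i : i \in ords2.
Proof. by case: i => [[|[|?]] ?]. Qed.

Lemma H1_enum : @enumerated H1 wheel_list (wheel_dist rim_dist).
Proof. by split; [|exact: wheel_list_all| |vm_compute]. Qed.

Lemma H2_enum : @enumerated H2 ords4 rim_dist.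
Proof. by split; [|exact: ords4_all| |vm_compute]. Qed.

Lemma H3_enum : @enumerated H3 ords4 (fun i j => i != j).
Proof. by split; [|exact: ords4_all| |vm_compute]. Qed.

Lemma H4_enum : @enumerated H4 wheel_list (wheel_dist cut_rim_dist).
Proof. by split; [|exact: wheel_list_all| |vm_compute]. Qed.

Lemma H5_enum : @enumerated H5 ords4 diamond_dist.
Proof. by split; [|exact: ords4_all| |vm_compute]. Qed.

Lemma K3_enum : @enumerated (complete_graph 3) ords3 (fun i j => i != j).
Proof. by split; [|exact: ords3_all| |vm_compute]. Qed.

Lemma K2_enum : @enumerated (complete_graph 2) ords2 (fun i j => i != j).
Proof. by split; [|exact: ords2_all| |vm_compute]. Qed.

Lemma H1_boundary : boundary H1 = [set~ (None : H1)].
Proof.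
apply/setP => v; rewrite (enum_boundary H1_enum) !inE.
apply/eqP; move: v; apply: (enum_forall H1_enum); by vm_compute.
Qed.

Lemma H1_beta (v : H1) : v \in boundary H1 -> beta v = 3%R.
Proof.
rewrite H1_boundary !inE => vN.
apply: (enum_beta H1_enum); apply/implyP: vN.
by move: v; apply: (enum_forall H1_enum); vm_compute.
Qed.

Lemma H2_beta (v : H2) : beta v = 2%R.
Proof.
apply: (enum_beta H2_enum).
by move: v; apply: (enum_forall H2_enum); vm_compute.
Qed.

Lemma H3_beta (v : H3) : beta v = 1%R.
Proof.
apply: (enum_beta H3_enum).
by move: v; apply: (enum_forall H3_enum); vm_compute.
Qed.

Lemma H3_attach_set : attach_set H3 = [set: H3].
Proof.
apply/setP => v; rewrite !inE H3_beta eqxx andbT.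
rewrite (enum_boundary H3_enum).
apply/eqP; move: v; apply: (enum_forall H3_enum); by vm_compute.
Qed.

Lemma H4_boundary : boundary H4 = [set~ (None : H4)].
Proof.
apply/setP => v; rewrite (enum_boundary H4_enum) !inE.
apply/eqP; move: v; apply: (enum_forall H4_enum); by vm_compute.
Qed.

Lemma H4_beta (v : H4) : v \in boundary H4 -> beta v = 2%R.
Proof.
rewrite H4_boundary !inE => vN.
apply: (enum_beta H4_enum); apply/implyP: vN.
by move: v; apply: (enum_forall H4_enum); vm_compute.
Qed.

Lemma H5_beta3 (v : H5) : deg v = 3 -> beta v = 1%R.
Proof.
rewrite (enum_deg H5_enum) => /eqP v3.
apply: (enum_beta H5_enum); apply/implyP: v3.
by move: v; apply: (enum_forall H5_enum); vm_compute.
Qed.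

Lemma H5_beta2 (v : H5) : deg v = 2 -> beta v = 2%R.
Proof.
rewrite (enum_deg H5_enum) => /eqP v3.
apply: (enum_beta H5_enum); apply/implyP: v3.
by move: v; apply: (enum_forall H5_enum); vm_compute.
Qed.

Lemma H5_boundary (v : H5) : v \in boundary H5.
Proof.
rewrite (enum_boundary H5_enum).
by move: v; apply: (enum_forall H5_enum); vm_compute.
Qed.

Lemma H5_deg (v : H5) : deg v = 3 \/ deg v = 2.
Proof.
rewrite (enum_deg H5_enum).
suff /orP[/eqP|/eqP] : (count (edge v) ords4 == 3) || (count (edge v) ords4 == 2);
  [by left|by right|].
by move: v; apply: (enum_forall H5_enum); vm_compute.
Qed.

Lemma H5_attach_set : attach_set H5 = [set v : H5 | deg v == 3].
Proof.
apply/setP => v; rewrite !inE H5_boundary /=.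
by case: (H5_deg v) => e; rewrite e ?(H5_beta3 e) ?(H5_beta2 e).
Qed.

Lemma K3_attach_set (v : complete_graph 3) : v \in attach_set (complete_graph 3).
Proof.
rewrite inE (enum_boundary K3_enum); apply/andP; split.
  by move: v; apply: (enum_forall K3_enum); vm_compute.
apply/eqP/(enum_beta K3_enum).
by move: v; apply: (enum_forall K3_enum); vm_compute.
Qed.

(** A path with at least two vertices is [complete_graph 2] with paths attached at both ends, which
    brings boundaries of size two into the same scheme as the other cores. *)
Lemma K2_attach_set (v : complete_graph 2) : v \in attach_set (complete_graph 2).
Proof.
rewrite inE (enum_boundary K2_enum); apply/andP; split.
  by move: v; apply: (enum_forall K2_enum); vm_compute.
apply/eqP/(enum_beta K2_enum).
by move: v; apply: (enum_forall K2_enum); vm_compute.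
Qed.

Definition core_graph (H : sgraph) (n : nat) : Prop :=
  [/\ connected H, 1 < #|{: H}| & #|boundary H| = n].

Lemma H1_core : core_graph H1 4.
Proof.
split; first exact: (enum_connected H1_enum).
  by rewrite (enum_card H1_enum).
by rewrite H1_boundary cardsC1 (enum_card H1_enum).
Qed.

Lemma H4_core : core_graph H4 4.
Proof.
split; first exact: (enum_connected H4_enum).
  by rewrite (enum_card H4_enum).
by rewrite H4_boundary cardsC1 (enum_card H4_enum).
Qed.

Lemma H2_core : core_graph H2 4.
Proof.
split; first exact: (enum_connected H2_enum).
  by rewrite (enum_card H2_enum).
apply: etrans (enum_card H2_enum); apply: eq_card => v.
rewrite (enum_boundary H2_enum) inE.
by apply/eqP; move: v; apply: (enum_forall H2_enum); vm_compute.
Qed.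

Lemma H3_core : core_graph H3 4.
Proof.
split; first exact: (enum_connected H3_enum).
  by rewrite (enum_card H3_enum).
apply: etrans (enum_card H3_enum); apply: eq_card => v.
by have : v \in attach_set H3; [rewrite H3_attach_set | rewrite inE => /andP[-> _]].
Qed.

Lemma H5_core : core_graph H5 4.
Proof.
split; first exact: (enum_connected H5_enum).
  by rewrite (enum_card H5_enum).
apply: etrans (enum_card H5_enum); apply: eq_card => v.
by rewrite H5_boundary.
Qed.

Lemma K3_core : core_graph (complete_graph 3) 3.
Proof.
split; first exact: (enum_connected K3_enum).
  by rewrite (enum_card K3_enum).
apply: etrans (enum_card K3_enum); apply: eq_card => v.
by have := K3_attach_set v; rewrite inE => /andP[-> _].
Qed.

Lemma K2_core : core_graph (complete_graph 2) 2.
Proof.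
split; first exact: (enum_connected K2_enum).
  by rewrite (enum_card K2_enum).
apply: etrans (enum_card K2_enum); apply: eq_card => v.
by have := K2_attach_set v; rewrite inE => /andP[-> _].
Qed.

(** * Boundary of the double forks *)

Section ForkBoundary.

Variables (cd : bool) (k : nat).
Local Notation H := (double_fork cd k).

Lemma fork_connected : connected H.
Proof.
apply: (@step_connected H (@fork_dist cd k)); last exact: fork_step.
by apply/card_gt0P; exists (inr ord0).
Qed.

Lemma fork_gt1 : 1 < #|{: H}|.
Proof. by rewrite card_sum !card_ord. Qed.

(** The right-hand side is the level of the next vertex on the way to [u]. Equal levels leave only
    the nonadjacent pair c, d, whose geodesic passes through m' at level k+1. *)
Lemma fork_closer_pos (v u w : H) : edge v w -> dist w u < dist v u -> w != u ->
  exists2 s, w = inr s & s.+1 =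
    if fork_pos v < fork_pos u then (fork_pos v).+1
    else if fork_pos u < fork_pos v then (fork_pos v).-1 else k.+1.
Proof.
rewrite -fork_dist_eq1 !dist_fork => vw lw wu.
suff : if w is inr s then s.+1 == if fork_pos v < fork_pos u then (fork_pos v).+1
    else if fork_pos u < fork_pos v then (fork_pos v).-1 else k.+1 else false.
  by case: (w) => // s /eqP e; exists s.
move: vw lw wu; rewrite /fork_dist.
case: v u w => [i|r] [j|s] [m|t]; rewrite ?eq_inl ?eq_inr.
all: try ord4_cases i; try ord4_cases j; try ord4_cases m; rewrite /= ?eqxx ?orbT ?orbF /=.
all: try have := ltn_ord r; try have := ltn_ord s; try have := ltn_ord t.
all: by case: (cd); iflia.
Qed.

Lemma fork_closer_unique (v u w w' : H) : edge v w -> edge v w' ->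
  dist w u < dist v u -> dist w' u < dist v u -> w = w'.
Proof.
move=> vw vw' lw lw'.
have near z z' : edge v z -> z = u -> dist z' u < dist v u -> z' = u.
  move=> vz zu lz'; rewrite zu in vz; move: lz'.
  rewrite (edge_dist1 fork_connected vz) ltnS leqn0 (dist_eq0 fork_connected).
  by move/eqP.
have [wu|wu] := eqVneq w u; first by rewrite wu; apply/esym/(near w).
have [w'u|w'u] := eqVneq w' u; first by rewrite w'u; apply: (near w').
have [s -> es] := fork_closer_pos vw lw wu; have [t -> et] := fork_closer_pos vw' lw' w'u.
by congr inr; apply: ord_inj; apply: succn_inj; rewrite es et.
Qed.

Lemma fork_boundary_inr (t : 'I_k.+1) : (inr t : H) \notin boundary H.
Proof.
apply: (nonboundary_crit fork_connected fork_gt1) => u w vw lw; split.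
  by move=> w' vw' lw'; apply: fork_closer_unique vw' vw lw' lw.
have inordE n : n <= k -> (inord n : 'I_k.+1) = n :> nat by move=> nk; rewrite inordK.
have tk := ltn_ord t.
have u_neq : u != inr t by apply: contraTneq lw => ->; rewrite dist0.
suff [z zP] : exists z : H, (fork_dist cd (inr t : H) z == 1) && (fork_dist cd (inr t : H) u
  < fork_dist cd z u).
  by case/andP: zP => tz lz; exists z; rewrite ?dist_fork // -fork_dist_eq1.
(* The level of [inr t] is [t.+1]; the farther neighbour is taken on the side away from [u]. *)
have [lt_u|lt_u] := ltnP t.+1 (fork_pos u).
  have [t0|t0] := posnP t.
    exists (inl (@Ordinal 4 0 isT)); rewrite /fork_dist /=; move: lt_u u_neq.
    by case: u {lw} => [i|s]; rewrite ?eq_inl ?eq_inr /=; [ord4_cases i|]; case: (cd) => /=;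
      iflia.
  exists (inr (inord t.-1)); rewrite /fork_dist ?eq_inr /= inordE; last by lia.
  by move: lt_u u_neq; case: u {lw} => [i|s]; rewrite ?eq_inl ?eq_inr /=; [ord4_cases i|];
    rewrite ?inordE; try lia; case: (cd) => /=; iflia.
have [ek|ek] := eqVneq (t : nat) k.
  exists (inl (@Ordinal 4 2 isT)); rewrite /fork_dist /=; move: lt_u u_neq.
  by case: u {lw} => [i|s]; rewrite ?eq_inl ?eq_inr /=; [ord4_cases i|]; case: (cd) => /=;
    iflia.
have tk' : t.+1 <= k by lia.
exists (inr (inord t.+1)); rewrite /fork_dist ?eq_inr /= inordE //.
by move: lt_u u_neq; case: u {lw} => [i|s]; rewrite ?eq_inl ?eq_inr /=; [ord4_cases i|];
  rewrite ?inordE //; case: (cd) => /=; iflia.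
Qed.

Lemma fork_boundary_inl (i : 'I_4) : (inl i : H) \in boundary H.
Proof.
(* The target sits at the opposite end of the fork; the twin of [i], if adjacent, is equally far
   from it. *)
apply: (boundary_crit fork_connected fork_gt1
  (u := inl (if i < 2 then @Ordinal 4 2 isT else @Ordinal 4 0 isT))
  (w := inr (if i < 2 then ord0 else ord_max))).
- by rewrite -fork_dist_eq1 /fork_dist; ord4_cases i; case: (cd) => /=; iflia.
- by rewrite !dist_fork /fork_dist; ord4_cases i; case: (cd) => /=; rewrite ?eq_inl /=; iflia.
move=> w'; rewrite -fork_dist_eq1 !dist_fork /fork_dist.
case: w' => [j|s]; rewrite ?eq_inl /=; last first.
  by ord4_cases i => /=; have := ltn_ord s; case: (cd) => /=; iflia.
by ord4_cases i => /=; ord4_cases j => /=; rewrite ?eqxx /=; case: (cd) => /=; iflia.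
Qed.

Lemma fork_attach_set : attach_set H = [set (inl i : H) | i : 'I_4].
Proof.
apply/setP => v; apply/idP/imsetP => [|[i _ ->]].
  case: v => [i _|t]; first by exists i.
  by rewrite inE (negPf (fork_boundary_inr t)).
apply: (attach_set_crit fork_connected fork_gt1); last exact: fork_boundary_inl.
move=> u; apply: (@leq_trans 1) => //; apply: closer_le1 => w w'.
exact: fork_closer_unique.
Qed.

Lemma fork_core : core_graph H 4.
Proof.
split; [exact: fork_connected | exact: fork_gt1 |].
have inj : injective (inl : 'I_4 -> H) by move=> i j [].
rewrite -[RHS](card_ord 4) -cardsT -(card_imset _ inj); apply: eq_card => v.
apply/idP/imsetP => [|[i _ ->]]; last exact: fork_boundary_inl.
by case: v => [i _|t]; [exists i | rewrite (negPf (fork_boundary_inr t))].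
Qed.

End ForkBoundary.

(** * Paths and trees *)

(** The path is cut at the edge between [l o0] and [(l o0).+1], and heights count outwards from this
    edge. *)
Lemma path_isomorphic n (l : complete_graph 2 -> nat) :
  n = (l (@Ordinal 2 0 isT) + l (@Ordinal 2 1 isT)).+2 -> isomorphic (path_graph n) (attach l).
Proof.
set o0 : complete_graph 2 := @Ordinal 2 0 isT;
  set o1 : complete_graph 2 := @Ordinal 2 1 isT => en.
pose c (i : path_graph n) : complete_graph 2 := if i <= l o0 then o0 else o1.
pose h (i : path_graph n) := if i <= l o0 then l o0 - i else i - (l o0).+1.
have e01 : edge o0 o1 by [].
have e10 : edge o1 o0 by [].
apply: (@coded_isomorphic _ _ l c h).
- by move=> i; have := ltn_ord i; rewrite /c /h; case: ifP; lia.
- move=> i j; rewrite /c /h; case: ifP => ci; case: ifP => cj // _ e; apply: ord_inj; lia.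
- move=> v m; have [->|->] : v = o0 \/ v = o1.
    by case: v => [[|[|?]] ?] //; [left|right]; apply: val_inj.
  + move=> ml; have lt_n : l o0 - m < n by lia.
    have le : l o0 - m <= l o0 by lia.
    by exists (Ordinal lt_n); rewrite /c /h /= le //; lia.
  + move=> ml; have lt_n : (l o0 + m).+1 < n by lia.
    have le : ((l o0 + m).+1 <= l o0) = false by lia.
    by exists (Ordinal lt_n); rewrite /c /h /= le //; lia.
- move=> i j; have -> : edge i j = (i != j :> nat) && ((j == i.+1 :> nat) || (i == j.+1 :>
  nat)) by [].
  rewrite /c /h; have := ltn_ord i; have := ltn_ord j.
  case: ifP => ci; case: ifP => cj; rewrite ?eqxx ?edge_irrefl ?e01 ?e10 /=; lia.
Qed.

Section Trees.

Variable G : sgraph.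
Hypothesis connG : connected G.

Lemma acyclic_small : #|{: G}| <= 2 -> acyclic G.
Proof.
move=> G2 s s_gt2 /andP[_ /card_uniqP us].
by have := max_card (mem s); rewrite us; lia.
Qed.

Hypothesis acycG : acyclic G.

(** Two neighbours of [v] that are no farther from [u] than [v] have geodesics to [u] avoiding [v].
    They are then joined outside [v], and [v] closes a cycle. *)
Lemma acyclic_farther (v u w w' : G) : edge v w -> edge v w' -> w != w' ->
  dist w u <= dist v u -> dist v u < dist w' u.
Proof.
move=> vw vw' ww' lw; rewrite ltnNge; apply/negP => lw'.
pose e : rel G := [rel x y | [&& edge x y, x != v & y != v]].
have e_sym : symmetric e by move=> x y; rewrite /e /= edge_sym [(x != v) && _]andbC.
have to_u n : forall x, x != v -> dist x u <= dist v u -> dist x u = n -> connect e x u.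
  elim: n => [|n IHn] x xv lx dx.
    by move/eqP: dx; rewrite (dist_eq0 connG) => /eqP ->.
  have xu : x != u by rewrite -(dist_gt0 connG) dx.
  have [z xz dz] := dist_step connG xu.
  have zv : z != v by apply/eqP => zv; rewrite zv in dz; lia.
  have exz : e x z by rewrite /e /= xz xv zv.
  by apply: connect_trans (connect1 exz) (IHn z zv _ _); slia.
have wv : w != v by rewrite eq_sym; apply: edge_neq.
have w'v : w' != v by rewrite eq_sym; apply: edge_neq.
have /connectP[p ep lp] : connect e w w'.
  apply: connect_trans (to_u _ w wv lw erefl) _.
  by rewrite (sym_connect_sym e_sym); apply: (to_u _ w' w'v lw' erefl).
case/shortenP: ep lp => q eq uq _ lq.
have q_nil : q != [::] by apply/eqP => q0; move: ww'; rewrite lq q0 eqxx.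
apply: (acycG (c := v :: w :: q)); first by case: (q) q_nil.
have vq : v \notin q.
  apply/negP => vq; have : all (fun y => y != v) q.
    elim: (q) (w) eq => //= y s IHs x /andP[/and3P[_ _ yv] /IHs]; by rewrite yv.
  by move/allP/(_ v vq); rewrite eqxx.
apply/andP; split; last by rewrite cons_uniq inE negb_or eq_sym wv vq.
rewrite /= vw rcons_path -lq edge_sym vw' andbT.
by apply: sub_path eq => x y /and3P[].
Qed.

(** By [acyclic_farther] at most one neighbour is not farther from a given target, so a vertex of
    degree at least two never has positive excess. *)
Lemma tree_boundary : 1 < #|{: G}| -> boundary G = leaves G.
Proof.
move=> G_gt1; apply/setP => v; rewrite [RHS]inE.
have dv := deg_gt0 connG v G_gt1.
have [d1|d1] := eqVneq (deg v) 1.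
  move/eqP/cards1P: d1 => [c Nc].
  have nb w : edge v w = (w == c) by have := in_set1 w c; rewrite -Nc inE => ->.
  have vc : edge v c by rewrite nb eqxx.
  apply: (boundary_crit connG G_gt1 (u := c) vc).
    by rewrite dist0 (dist_gt0 connG) edge_neq.
  by move=> w; rewrite nb => /eqP ->; rewrite dist0.
apply/negbTE/(nonboundary_crit connG G_gt1) => u w vw lw; split.
  move=> w' vw' lw'; apply/eqP; apply/negPn/negP => ww'.
  have := acyclic_farther vw' vw ww' (ltnW lw'); lia.
have : 1 < deg v by lia.
case/card_gt1P => x [y [xN yN xy]]; rewrite !inE in xN yN.
have [xw|xw] := eqVneq w x.
  by exists y => //; apply: (acyclic_farther vw) (ltnW lw); rewrite // xw.
by exists x => //; apply: (acyclic_farther vw) (ltnW lw).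
Qed.

End Trees.

Lemma leaf_acyclic (G : sgraph) (b c : G) : edge b c -> (forall w, edge b w -> w = c) ->
  acyclic (del_vertex b) -> acyclic G.
Proof.
move=> bc leaf_b acyc s s_gt2 /andP[cyc us].
have [bs|bs] := boolP (b \in s).
  (* Rotated to start at [b], the cycle has [c] both as its second and as its last vertex. *)
  have [i s' def_s] := rot_to bs.
  move: cyc us s_gt2; rewrite -(rot_cycle i) -(rot_uniq i) -(size_rot i) def_s /=.
  case: s' {def_s} => [//|x s'] /= /andP[/leaf_b -> p] /andP[_ /andP[cs us]] s2.
  move: p cs; rewrite rcons_path => /andP[_]; rewrite edge_sym => /leaf_b.
  case: s' us s2 => [//|y s'] _ _ /= lc.
  by rewrite -[X in X \in _]lc mem_last.
pose s' : seq (del_vertex b) := pmap insub s.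
have def_s : map val s' = s.
  rewrite pmap_filter ?filter_pmap; last exact: insubK.
  apply/all_filterP/allP => x xs; rewrite isSome_insub.
  by apply: contraNneq bs => <-.
apply: (acyc s'); first by rewrite -(size_map val) def_s.
apply/andP; split; last by rewrite -(map_inj_uniq val_inj) def_s.
move: cyc; rewrite -def_s; case: (s') => //= x p.
by rewrite -map_rcons path_map.
Qed.

(** * Classification *)

(** A counterpart of [attach_grow]: the end of a path attached at an admissible vertex still has
    excess at most 1, so a leaf added there leaves the boundary size unchanged. *)
Lemma attach_end_closer (H : sgraph) (l : H -> nat) (x u : attach l) :
  connected H -> 1 < #|{: H}| -> tag x \in attach_set H -> height x = l (tag x) ->
  closer x u <= (farther x u).+1.
Proof.
move=> connH H_gt1 vA hx; rewrite -(attK x) hx; set v := tag x in vA *.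
have [l0|l0] := posnP (l v); last first.
  apply: (@leq_trans 1) => //; apply: closer_le1 => w w'.
  move=> /(attach_nbr_pos l0 (leqnn _)) Ew /(attach_nbr_pos l0 (leqnn _)) Ew' _ _.
  by case: Ew => [->|[]]; case: Ew' => [->|[]]; rewrite ?ltnn.
rewrite l0; have [uv|uv] := eqVneq (tag u) v.
  have -> : u = att l v 0.
    by apply/eqP; rewrite att_eq uv tag_att height_att // eqxx; have := height_le u;
      rewrite uv l0 leqn0.
  by rewrite closer_self.
by rewrite closer_att0 // farther_att0 // l0 addn0; apply: attach_set_closer.
Qed.

Lemma obtained_from_core (H G : sgraph) : isomorphic G H -> obtained_from H G.
Proof.
move=> GH; exists (fun _ => 0); split=> //.
exact: isomorphic_trans GH (attach0_isomorphic H).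
Qed.

Lemma obtained_from_boundary (H G : sgraph) n : connected G -> core_graph H n ->
  obtained_from H G -> #|boundary G| = n.
Proof.
move=> connG [connH H_gt1 <-] [l [l_supp GA]].
by rewrite (iso_card_boundary connG GA) (card_attach_boundary connH H_gt1 l_supp).
Qed.

Lemma is_tripodE (G : sgraph) : is_tripod G <-> obtained_from (complete_graph 3) G.
Proof.
split=> [[l GA]|[l [_ GA]]]; exists l => //; split=> // v.
by rewrite K3_attach_set.
Qed.

Definition four_family (G : sgraph) : Prop :=
  obtained_from H1 G \/ obtained_from H2 G \/ obtained_from H3 G \/
  obtained_from H4 G \/ obtained_from H5 G \/
  (exists k : nat, obtained_from (H6 k) G) \/ (exists k : nat, obtained_from (H7 k) G).

Lemma four_family_map (G G' : sgraph) :
  (forall H, core_graph H 4 -> obtained_from H G -> obtained_from H G') ->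
  four_family G -> four_family G'.
Proof.
move=> f; case=> [/(f _ H1_core)|[/(f _ H2_core)|[/(f _ H3_core)|[/(f _ H4_core)|
  [/(f _ H5_core)|[[k /(f _ (fork_core true k))]|[k /(f _ (fork_core false k))]]]]]]] h.
- by left.
- by right; left.
- by do 2 right; left.
- by do 3 right; left.
- by do 4 right; left.
- by do 5 right; left; exists k.
- by do 6 right; exists k.
Qed.

Lemma four_family_boundary (G : sgraph) : connected G -> four_family G -> #|boundary G| = 4.
Proof.
move=> connG; have f H : core_graph H 4 -> obtained_from H G -> #|boundary G| = 4.
  by move=> gH; apply: obtained_from_boundary.
case=> [/(f _ H1_core)|[/(f _ H2_core)|[/(f _ H3_core)|[/(f _ H4_core)|
  [/(f _ H5_core)|[[k /(f _ (fork_core true k))]|[k /(f _ (fork_core false k))]]]]]]] //.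
Qed.

(** The invariant of the induction on leaves. For size two, the form over [complete_graph 2] serves
    when the path is lengthened, and being a tree serves when a leaf creates a third boundary
    vertex. *)
Definition small_class (G : sgraph) : Prop :=
  #|{: G}| = 1 \/
  (#|boundary G| = 2 /\ is_tree G /\ obtained_from (complete_graph 2) G) \/
  (#|boundary G| = 3 /\ (is_tree G \/ obtained_from (complete_graph 3) G)) \/
  (#|boundary G| = 4 /\ (is_tree G \/ four_family G)).

Lemma leafless_small_class (G : sgraph) : connected G -> 1 < #|{: G}| ->
  (forall v w : G, edge v w -> exists2 w', edge v w' & w' != w) ->
  #|boundary G| <= 4 -> small_class G.
Proof.
move=> connG G_gt1 leafless /(leafless_classification connG G_gt1 leafless).
case=> [/obtained_from_core K3G|Hcase].
  right; right; left; rewrite (obtained_from_boundary connG K3_core K3G).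
  by split=> //; right.
have fam : four_family G.
  rewrite /four_family; case: Hcase => [/obtained_from_core h|[/obtained_from_core h|
    [/obtained_from_core h|[/obtained_from_core h|[/obtained_from_core h|[k
      /obtained_from_core h]]]]]]; try tauto.
  by do 5 right; left; exists k.
right; right; right; rewrite (four_family_boundary connG fam).
by split=> //; right.
Qed.

Lemma two_vertices_class (G : sgraph) (b c : G) : connected G -> edge b c ->
  #|{: G}| = 2 -> small_class G.
Proof.
move=> connG bc G2; right; left.
have GK : isomorphic G (complete_graph 2).
  apply: (@isomorphic_dist G (complete_graph 2) (fun i j => i != j)
    (fun i => if i == 0 :> nat then b else c) connG).
  - by case=> [[|[|?]] ?] [[|[|?]] ?].
  - by case=> [[|[|?]] ?] [[|[|?]] ?].
  - move=> y.
    have leaf_nbr_neq' : b != c by apply: edge_neq.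
    have : [set b; c] = [set: G].
      by apply/eqP; rewrite eqEcard subsetT cardsT G2 cards2 leaf_nbr_neq'.
    move=> /setP/(_ y); rewrite !inE => /orP[/eqP->|/eqP->].
      by exists (@Ordinal 2 0 isT).
    by exists (@Ordinal 2 1 isT).
  have := edge_dist1 connG bc => d1.
  by case=> [[|[|?]] ?] [[|[|?]] ?] //=; rewrite ?dist0 // dist_sym.
have o2 := obtained_from_core GK.
split; first exact: obtained_from_boundary K2_core o2.
by split=> //; split=> //; apply: acyclic_small; rewrite G2.
Qed.

Lemma leaf_small_class (G : sgraph) (b c : G) : connected G -> edge b c ->
  (forall w, edge b w -> w = c) -> small_class (del_vertex b) ->
  #|boundary G| <= 4 -> small_class G.
Proof.
move=> connG bc leaf_b IH le4.
have connG' := del_connected connG bc leaf_b.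
have [G'1|G'_gt1] : #|{: del_vertex b}| = 1 \/ 1 < #|{: del_vertex b}|.
  by have := connG'.1; case: #|_| => [|[|n]] // _; [left | right].
  by apply: (two_vertices_class connG bc); rewrite (card_del_vertex b) G'1.
have tree : is_tree (del_vertex b) -> is_tree G.
  by case=> _ acyc; split=> //; apply: (leaf_acyclic bc leaf_b).
set c' := del_c bc.
have [same|nsame] : (c' \in boundary (del_vertex b) /\
    forall u, closer c' u <= (farther c' u).+1) \/
  ~ (c' \in boundary (del_vertex b) /\ forall u, closer c' u <= (farther c' u).+1).
- have [cB|cB] := boolP (c' \in boundary (del_vertex b)); last by right => -[].
  have [/forallP le1|no] := boolP [forall u, closer c' u <= (farther c' u).+1].
    by left.
  by right => -[_ le1]; case/negP: no; apply/forallP.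
- have [cB le1] := same.
  have eB := card_boundary_del_same connG leaf_b G'_gt1 cB le1.
  have grow H n : core_graph H n -> obtained_from H (del_vertex b) -> obtained_from H G.
    move=> [connH H_gt1 _] o.
    exact: (obtained_grow connG leaf_b connH H_gt1 G'_gt1 o cB le1).
  case: IH => [e|[[e [t o]]|[[e o]|[e o]]]]; first by rewrite e in G'_gt1.
  + right; left; rewrite eB; split=> //; split; first exact: tree.
    exact: grow K2_core o.
  + right; right; left; rewrite eB; split=> //.
    by case: o => [/tree|/(grow _ _ K3_core)]; [left | right].
  + right; right; right; rewrite eB; split=> //.
    case: o => [/tree|o]; [by left | right].
    by apply: four_family_map o => H gH; apply: grow gH.
(* From here on the boundary grows by one: a path becomes a tree, a tripod becomes an [H7], and size
   four is stopped by [le4]. *)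
have eB := card_boundary_del_succ connG leaf_b G'_gt1 nsame.
case: IH => [e|[[e [t o]]|[[e o]|[e o]]]]; first by rewrite e in G'_gt1.
- by right; right; left; rewrite eB e; split=> //; left; apply: tree.
- right; right; right; rewrite eB e; split=> //.
  case: o => [/tree|[l [l_supp [f fb fm]]]]; [by left | right].
  have [connK K_gt1 _] := K3_core.
  have [lt_i|ge_i] := ltnP (height (f c')) (l (tag (f c'))).
    have [l' l'0 GA] := tripod_grow leaf_b fb fm erefl erefl lt_i.
    do 6 right; exists (height (f c')), l'; split=> // -[i|t] //.
    by rewrite /H7 fork_attach_set => /negP; case; apply: imset_f.
  (* A leaf at the end of a tripod leg belongs to the case of equal boundary sizes, which [nsame]
     excludes. *)
  case: nsame; have hc : height (f c') = l (tag (f c')).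
    by apply/eqP; rewrite eqn_leq ge_i height_le.
  split.
    rewrite -(iso_boundary connG' fb fm) (attach_boundary connK K_gt1 l_supp) hc eqxx andbT.
    by have := K3_attach_set (tag (f c')); rewrite inE => /andP[].
  move=> u; rewrite -(iso_closer connG' fb fm _ _).1 -(iso_closer connG' fb fm _ _).2.
  by apply: attach_end_closer => //; apply: K3_attach_set.
by move: le4; rewrite eB e.
Qed.

Theorem small_boundary_class (G : sgraph) :
  connected G -> #|boundary G| <= 4 -> small_class G.
Proof.
move: {2}#|{: G}| (leqnn #|{: G}|) => n; elim: n G => [|n IHn] G le_n connG le4.
  by have := connG.1; rewrite leqn0 in le_n; rewrite (eqP le_n).
have [G1|G_gt1] : #|{: G}| = 1 \/ 1 < #|{: G}|.
  by have := connG.1; case: #|_| => [|[|m]] // _; [left | right].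
  by left.
have [/existsP[b /eqP/eqP/cards1P[c Nc]]|no] := boolP [exists b : G, deg b == 1].
  have nb w : edge b w = (w == c) by have := in_set1 w c; rewrite -Nc inE => ->.
  have bc : edge b c by rewrite nb eqxx.
  have leaf_b w : edge b w -> w = c by rewrite nb => /eqP.
  apply: (leaf_small_class connG bc leaf_b) => //.
  have connG' := del_connected connG bc leaf_b.
  have [G'1|G'_gt1] : #|{: del_vertex b}| = 1 \/ 1 < #|{: del_vertex b}|.
    by have := connG'.1; case: #|_| => [|[|m]] // _; [left | right].
    by left.
  apply: IHn => //; first by move: le_n; rewrite (card_del_vertex b) ltnS.
  have [cB|cB] := boolP (del_c bc \in boundary (del_vertex b)).
    have [/forallP le1|nle] := boolP [forall u, closer (del_c bc) u <= (farther (del_c bc)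
      u).+1].
      by rewrite -(card_boundary_del_same connG leaf_b G'_gt1 cB le1).
    rewrite -ltnS -(card_boundary_del_succ connG leaf_b G'_gt1 (bc := bc)) //;
      first exact: leqW.
    by case=> _ le1; case/negP: nle; apply/forallP.
  rewrite -ltnS -(card_boundary_del_succ connG leaf_b G'_gt1 (bc := bc)) //; first exact: leqW.
  by case; rewrite (negPf cB).
apply: leafless_small_class => // v w vw.
have dv : 1 < deg v.
  have := deg_gt0 connG v G_gt1; move: no; rewrite negb_exists => /forallP/(_ v).
  by case: (deg v) => [|[|m]].
case/card_gt1P: dv => x [y [xN yN xy]]; rewrite !inE in xN yN.
by have [xw|xw] := eqVneq x w; [exists y; rewrite // -xw eq_sym | exists x].
Qed.

Lemma tree_card_boundary (G : sgraph) n : 1 < n -> is_tree G ->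
  #|boundary G| = n \/ #|leaves G| = n -> #|boundary G| = n /\ #|leaves G| = n.
Proof.
move=> n1 [connG acyc] E.
have G_gt1 : 1 < #|{: G}|.
  by apply: leq_trans n1 _; case: E => <-; apply: max_card.
by rewrite (tree_boundary connG acyc G_gt1) in E *; case: E.
Qed.

Lemma boundary_single (G : sgraph) : #|{: G}| = 1 -> #|boundary G| = 1.
Proof. by move=> G1; rewrite /boundary G1 eqxx cardsT. Qed.

Lemma boundary2 (G : sgraph) : connected G ->
  #|boundary G| = 2 <-> (exists n, 2 <= n /\ isomorphic G (path_graph n)).
Proof.
move=> connG; split=> [B2|[n [n2 Gn]]].
  have le4 : #|boundary G| <= 4 by rewrite B2.
  have [/boundary_single|[[_ [_ [l [_ GA]]]]|[[]|[]]]] := small_boundary_class connG le4;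
    rewrite ?B2 //.
  eexists; split; last first.
    by apply: isomorphic_trans GA (isomorphic_sym (path_isomorphic erefl)).
  by [].
have [connK K_gt1 <-] := K2_core.
(* All [n - 2] further vertices go to one end of the edge. *)
pose l (i : complete_graph 2) := if i == 0 :> nat then n - 2 else 0.
have GA : isomorphic G (attach l).
  by apply: isomorphic_trans Gn (path_isomorphic _); rewrite /l /=; lia.
rewrite (iso_card_boundary connG GA) (card_attach_boundary connK K_gt1) // => v.
by rewrite K2_attach_set.
Qed.

Lemma boundary3 (G : sgraph) : connected G ->
  #|boundary G| = 3 <-> (is_tree G /\ #|leaves G| = 3) \/ is_tripod G.
Proof.
move=> connG; split=> [B3|[[tG L3]|/is_tripodE]].
- have le4 : #|boundary G| <= 4 by rewrite B3.
  have [/boundary_single|[[]|[[_ [tG|/is_tripodE]]|[]]]] := small_boundary_class connG le4;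
    rewrite ?B3 //; [left | right] => //.
  by split=> //; have [] := @tree_card_boundary G 3 isT tG (or_introl B3).
- by have [] := @tree_card_boundary G 3 isT tG (or_intror L3).
- exact: obtained_from_boundary K3_core.
Qed.

Lemma boundary4 (G : sgraph) : connected G ->
  #|boundary G| = 4 <-> (is_tree G /\ #|leaves G| = 4) \/ four_family G.
Proof.
move=> connG; split=> [B4|[[tG L4]|]].
- have le4 : #|boundary G| <= 4 by rewrite B4.
  have [/boundary_single|[[]|[[]|[_ [tG|]]]]] := small_boundary_class connG le4;
    rewrite ?B4 //; [left | right] => //.
  by split=> //; have [] := @tree_card_boundary G 4 isT tG (or_introl B4).
- by have [] := @tree_card_boundary G 4 isT tG (or_intror L4).
- exact: four_family_boundary.
Qed.

(* The second half records the values of the boundaries and of the boundary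
   stability numbers that are asserted in the description of the graphs H_i. *)
Theorem theorem1p2 :
  (forall G : sgraph, connected G ->
    [/\ #|boundary G| = 2 <->
          (exists n, 2 <= n /\ isomorphic G (path_graph n)),
        #|boundary G| = 3 <->
          (is_tree G /\ #|leaves G| = 3) \/ is_tripod G
      & #|boundary G| = 4 <->
          (is_tree G /\ #|leaves G| = 4) \/
          (obtained_from H1 G \/
           obtained_from H2 G \/
           obtained_from H3 G \/
           obtained_from H4 G \/
           obtained_from H5 G \/
           (exists k : nat, obtained_from (H6 k) G) \/
           (exists k : nat, obtained_from (H7 k) G))]) /\
  ((boundary H1 = [set~ (None : H1)] /\
    forall v : H1, v \in boundary H1 -> beta v = 3%R) /\
   (forall v : H2, beta v = 2%R) /\
   ((forall v : H3, beta v = 1%R) /\ attach_set H3 = [set: H3]) /\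
   (boundary H4 = [set~ (None : H4)] /\
    forall v : H4, v \in boundary H4 -> beta v = 2%R) /\
   ((forall v : H5, deg v = 3 -> beta v = 1%R) /\
    (forall v : H5, deg v = 2 -> beta v = 2%R) /\
    attach_set H5 = [set v : H5 | deg v == 3]) /\
   (forall k : nat, attach_set (H6 k) = [set (inl i : H6 k) | i : 'I_4]) /\
   (forall k : nat, attach_set (H7 k) = [set (inl i : H7 k) | i : 'I_4])).
Proof.
split; first by move=> G connG; split; [exact: boundary2 | exact: boundary3 | exact: boundary4].
split; first by split; [exact: H1_boundary | exact: H1_beta].
split; first exact: H2_beta.
split; first by split; [exact: H3_beta | exact: H3_attach_set].
split; first by split; [exact: H4_boundary | exact: H4_beta].
split; first by split; [exact: H5_beta3 | split; [exact: H5_beta2 | exact: H5_attach_set]].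
by split=> k; apply: fork_attach_set.
Qed.
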